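(* Let $\gamma\in(0,1)$ and let $f$ be a measurable real-valued function on $\mathbb{R}^{n+1}$. Then $f\in\{g\in\mathrm{BMO}^+(\gamma):\|g\|_{\mathrm{BMO}^+(\gamma)}=0\}$ if and only if there exists a non-decreasing function $\widetilde{f}:\mathbb{R}\to\mathbb{R}$ such that, for almost every $(x,t)\in\mathbb{R}^{n+1}$, $f(x,t)=\widetilde{f}(t)$.
   Context: Work in $\mathbb{R}^{n+1}$, with points $(x,t)$, $x\in\mathbb{R}^n$, $t\in\mathbb{R}$; $p\in(1,\infty)$ is fixed throughout. $Q(x,L)=\{y\in\mathbb{R}^n: x_i-\frac L2\le y_i<x_i+\frac L2 \text{ for all } i\in\{1,\dots,n\}\}$. A parabolic rectangle centered at $(x,t)$ with edge length $L\in(0,\infty)$ is $R=R(x,t,L)=Q(x,L)\times[t-L^p,t+L^p)$; $\mathcal{R}$ is the set of all parabolic rectangles. For $\gamma\in[0,1)$, $R^-(\gamma)=Q(x,L)\times[t-L^p,t-\gamma L^p)$ and $R^+(\gamma)=Q(x,L)\times[t+\gamma L^p,t+L^p)$. $f_A=\fint_A f=\frac1{|A|}\int_A f$, $f_+=\max\{f,0\}$. $\mathrm{BMO}^+(\gamma)$ is the set of all locally integrable real-valued functions $f$ on $\mathbb{R}^{n+1}$ with $$\|f\|_{\mathrm{BMO}^+(\gamma)}=\sup_{R\in\mathcal{R}}\fint_{R^-(\gamma)}[f-f_{R^+(\gamma)}]_+<\infty.$$ *)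

(* Defs.v *)
From HB Require Import structures.
From mathcomp Require Import all_boot all_order all_algebra.
From mathcomp Require Import all_classical all_reals all_analysis.
Import Order.TTheory GRing.Theory Num.Theory.
Import numFieldNormedType.Exports.

Set Implicit Arguments.
Unset Strict Implicit.
Unset Printing Implicit Defensive.

Local Open Scope classical_set_scope.
Local Open Scope ring_scope.

(** Borel sigma-algebra on row vectors: the one generated by the coordinates
    (as the library does for [n.-tuple T]). *)
Definition rV_display : measure_display -> measure_display.
Proof. exact. Qed.

Section measurable_rV.
Context (R : realType) (n : nat).

Let coord (i : 'I_n) (v : 'rV[R]_n) : measurableTypeR R := v ord0 i.

HB.instance Definition _ := @isMeasurable.Build
  (rV_display (R.-ocitv.-measurable).-sigma) 'rV[R]_n (g_sigma_preimage coord)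
  (@sigma_algebra0 _ _ _) (@sigma_algebraC _ _) (@sigma_algebra_bigcup _ _ _).

Lemma measurable_rV_coord i : measurable_fun [set: 'rV[R]_n] (coord i).
Proof.
move=> _ Y mY; rewrite setTI; apply: sub_sigma_algebra => /=.
rewrite -bigcup_seq/=; exists i => /=; first by rewrite mem_index_enum.
by exists Y => //; rewrite setTI.
Qed.

Lemma measurable_fun_rVP d (T : measurableType d) (f : T -> 'rV[R]_n) :
  (forall i, measurable_fun setT (fun x => f x ord0 i : measurableTypeR R)) ->
  measurable_fun setT f.
Proof.
move=> mf.
have fs : g_sigma_preimage (fun i => coord i \o f) `<=` measurable.
  apply: smallest_sub; first exact: sigma_algebra_measurable.
  rewrite -bigcup_seq; apply: bigcup_sub => i _.
  by move=> A [B mB <-]; exact: mf.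
move: fs; rewrite g_sigma_preimage_comp => fs _ A mA.
by apply: fs; exists A.
Qed.

End measurable_rV.

Lemma product_sigma_finite d1 d2 (T1 : measurableType d1)
    (T2 : measurableType d2) (R : realType)
    (m1 : {sigma_finite_measure set T1 -> \bar R})
    (m2 : {sigma_finite_measure set T2 -> \bar R}) :
  sigma_finite setT (m1 \x m2)%E.
Proof.
have /sigma_finiteP[F [TF ndF Foo]] := sigma_finiteT m1.
have /sigma_finiteP[G [TG ndG Goo]] := sigma_finiteT m2.
exists (fun n => F n `*` G n).
  rewrite -setXTT TF TG predeqE => -[x y]; split.
    move=> [/= [n _ Fnx] [k _ Gky]]; exists (maxn n k) => //; split.
    - by move: x Fnx; exact/subsetPset/ndF/leq_maxl.
    - by move: y Gky; exact/subsetPset/ndG/leq_maxr.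
  by move=> [n _ []/= ? ?]; split; exists n.
move=> k; have [? ?] := Foo k; have [? ?] := Goo k.
split; first exact: measurableX.
by rewrite product_measure1E// lte_mul_pinfty// ge0_fin_numE.
Qed.

(** Lebesgue measure on R^n, by recursion on n, as the iterated product of the
    one-dimensional Lebesgue measure, transported along
    R * R^n -> R^(n+1), (a, v) |-> (a, v_0, ..., v_(n-1)). *)
Section rV_cons.
Context (R : realType) (n : nat).

Definition rV_cons (z : measurableTypeR R * 'rV[R]_n) : 'rV[R]_n.+1 :=
  \row_i oapp (z.2 ord0) (z.1 : R) (unlift ord0 i).

Definition rV_uncons (w : 'rV[R]_n.+1) : measurableTypeR R * 'rV[R]_n :=
  (w ord0 ord0, \row_i w ord0 (lift ord0 i)).

Lemma rV_consK : cancel rV_cons rV_uncons.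
Proof.
move=> [a v]; rewrite /rV_uncons mxE unlift_none/=; congr pair.
by apply/rowP => i; rewrite !mxE liftK.
Qed.

Lemma rV_unconsK : cancel rV_uncons rV_cons.
Proof.
move=> w; apply/rowP => i; rewrite mxE.
by case: unliftP => [j ->|->] //=; rewrite mxE.
Qed.

Lemma measurable_rV_cons : measurable_fun setT rV_cons.
Proof.
apply: measurable_fun_rVP => i.
case: (unliftP ord0 i) => [j|] ->.
  rewrite (_ : (fun _ => _) =
    (fun v : 'rV[R]_n => v ord0 j : measurableTypeR R) \o snd).
    apply: measurableT_comp => //; exact: measurable_rV_coord.
  by apply/funext => z; rewrite /rV_cons mxE liftK.
rewrite (_ : (fun _ => _) = fst) //.
by apply/funext => z; rewrite /rV_cons mxE unlift_none.
Qed.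

Lemma measurable_rV_uncons : measurable_fun setT rV_uncons.
Proof.
apply: measurable_fun_pair; first exact: measurable_rV_coord.
apply: measurable_fun_rVP => i.
rewrite (_ : (fun _ => _) = fun w : 'rV[R]_n.+1 => w ord0 (lift ord0 i)).
  exact: measurable_rV_coord.
by apply/funext => w; rewrite mxE.
Qed.

Variable mu : {sigma_finite_measure set 'rV[R]_n -> \bar R}.

Definition rV_cons_measure : set 'rV[R]_n.+1 -> \bar R :=
  pushforward (@lebesgue_measure R \x mu)%E rV_cons.

Let rV_cons_measure0 : rV_cons_measure set0 = 0%E.
Proof. by rewrite /rV_cons_measure /pushforward preimage_set0 measure0. Qed.

Let rV_cons_measure_ge0 A : (0 <= rV_cons_measure A)%E.
Proof. by rewrite /rV_cons_measure /pushforward; exact: measure_ge0. Qed.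

Let rV_cons_measure_sigma_additive : semi_sigma_additive rV_cons_measure.
Proof.
exact: (@measure_semi_sigma_additive _ _ _
  (measure_function_pushforward__canonical__measure_function_Measure
     (@lebesgue_measure R \x mu)%E measurable_rV_cons)).
Qed.

HB.instance Definition _ := isMeasure.Build _ _ _ rV_cons_measure
  rV_cons_measure0 rV_cons_measure_ge0 rV_cons_measure_sigma_additive.

Let rV_cons_measure_sigma_finite : sigma_finite setT rV_cons_measure.
Proof.
have [F FT Foo] := product_sigma_finite (@lebesgue_measure R) mu.
exists (fun k => rV_uncons @^-1` F k).
  by rewrite -preimage_bigcup -FT preimage_setT.
move=> k; have [mF Fk] := Foo k; split.
  by rewrite -[X in measurable X]setTI; exact: measurable_rV_uncons.
rewrite /rV_cons_measure /pushforward -comp_preimage.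
rewrite (_ : _ \o _ = id) ?preimage_id//.
by apply/funext => z; rewrite /= rV_consK.
Qed.

HB.instance Definition _ := @Measure_isSigmaFinite.Build _ _ _
  rV_cons_measure rV_cons_measure_sigma_finite.

End rV_cons.

Fixpoint lebesgue_rV (R : realType) (n : nat) :
    {sigma_finite_measure set 'rV[R]_n -> \bar R} :=
  match n with
  | 0 => \d_(0 : 'rV[R]_0)
  | n'.+1 => rV_cons_measure (lebesgue_rV R n')
  end.

Lemma lebesgue_rV_box (R : realType) (n : nat) (a b : 'rV[R]_n) :
  (forall i, a ord0 i <= b ord0 i) ->
  lebesgue_rV R n [set v | forall i, a ord0 i <= v ord0 i < b ord0 i] =
  (\prod_i (b ord0 i - a ord0 i))%:E.
Proof.
elim: n a b => [|n IH] a b ab.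
  by rewrite big_ord0 /= diracE mem_set//= => -[].
have mbox m (c d : 'rV[R]_m) :
    measurable [set v : 'rV[R]_m | forall i, c ord0 i <= v ord0 i < d ord0 i].
  rewrite (_ : [set _ | _] = \bigcap_(i in [set: 'I_m])
      ((fun v : 'rV[R]_m => v ord0 i : measurableTypeR R) @^-1`
        `[c ord0 i, d ord0 i[)); last first.
    apply/seteqP; split => [v cvd i _|v cvd i] /=; first by rewrite in_itv/=.
    by have := cvd i I; rewrite /= in_itv.
  apply: fin_bigcap_measurable => // i _.
  by rewrite -[X in measurable X]setTI; exact: measurable_rV_coord.
rewrite /= /rV_cons_measure /pushforward.
rewrite [X in (_ \x _)%E X](_ : _ = `[a ord0 ord0, b ord0 ord0[ `*`
  [set v : 'rV[R]_n | forall i, (rV_uncons a).2 ord0 i <= v ord0 i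
                                < (rV_uncons b).2 ord0 i]); last first.
  apply/seteqP; split => [[x v] /= xv|[x v] /= [+ abv] i].
    split; first by have := xv ord0; rewrite mxE unlift_none in_itv.
    by move=> i; have := xv (lift ord0 i); rewrite !mxE liftK.
  rewrite in_itv/= mxE => abx; case: (unliftP ord0 i) => [j|] -> //=.
  by have := abv j; rewrite !mxE.
rewrite product_measure1E//=; last exact: mbox.
rewrite IH; last by move=> i; rewrite !mxE.
rewrite big_ord_recl lebesgue_measure_itv/= lte_fin.
have [_|ba] := ltP (a ord0 ord0) (b ord0 ord0).
  by rewrite -EFinB -EFinM; congr (_ * _)%:E; apply: eq_bigr => i _; rewrite !mxE.
have -> : b ord0 ord0 - a ord0 ord0 = 0.
  by apply/eqP; rewrite subr_eq0 eq_le ba ab.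
by rewrite mul0e mul0r.
Qed.

(** Lebesgue measure on R^n * R = R^(n+1), completed: [spacetime R n] carries
    the Lebesgue (Caratheodory) sigma-algebra, not just the Borel one. *)
Definition borel_spacetime (R : realType) (n : nat) :
    {measure set ('rV[R]_n * measurableTypeR R)%type -> \bar R} :=
  (lebesgue_rV R n \x @lebesgue_measure R)%E.

Definition spacetime (R : realType) (n : nat) :=
  caratheodory_type (mu_ext (borel_spacetime R n)).

Definition lebesgue_spacetime (R : realType) (n : nat) :
    {measure set (spacetime R n) -> \bar R} :=
  @completed_measure_extension _ _ _ (borel_spacetime R n).

Section parabolic_BMO.
Context (R : realType) (n : nat).
Implicit Types (f g : spacetime R n -> R) (A : set (spacetime R n)).

Local Notation mu := (lebesgue_spacetime R n).

(** Extended-real valued, so that it makes sense for every nonnegative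
    measurable function; when [f] is integrable on [A], f_A is [fine (mean A f)]. *)
Definition mean A f : \bar R :=
  (((fine (mu A))^-1)%:E * \int[mu]_(z in A) (f z)%:E)%E.

(** Compactness refers to the product topology of R^n * R. *)
Definition locally_integrable_spacetime f : Prop :=
  measurable_fun setT (f : spacetime R n -> measurableTypeR R) /\
  forall K : set ('rV[R]_n * R), compact K -> mu.-integrable K (EFin \o f).

Definition cube (x : 'rV[R]_n) (L : R) : set 'rV[R]_n :=
  [set y | forall i, x ord0 i - L / 2 <= y ord0 i < x ord0 i + L / 2].

(** Data of R(x,t,L) = cube x L * [t - L^p, t + L^p[; [lower_part] and
    [upper_part] below are R^-(gamma) and R^+(gamma). *)
Record parabolic_rectangle := ParabolicRectangle {
  center_x : 'rV[R]_n;
  center_t : R;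
  edge : R;
  edge_gt0 : 0 < edge }.

Variables p gamma : R.

Definition lower_part (Q : parabolic_rectangle) : set (spacetime R n) :=
  cube (center_x Q) (edge Q) `*`
  `[center_t Q - edge Q `^ p, center_t Q - gamma * edge Q `^ p[.

Definition upper_part (Q : parabolic_rectangle) : set (spacetime R n) :=
  cube (center_x Q) (edge Q) `*`
  `[center_t Q + gamma * edge Q `^ p, center_t Q + edge Q `^ p[.

Definition BMOplus_norm f : \bar R :=
  ereal_sup (range (fun Q : parabolic_rectangle =>
    mean (lower_part Q)
      (fun z => Num.max (f z - fine (mean (upper_part Q) f)) 0))).

Definition BMOplus : set (spacetime R n -> R) :=
  [set f | locally_integrable_spacetime f /\ (BMOplus_norm f < +oo)%E].

End parabolic_BMO.

(* Main.v *)
Require Import Defs.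
From mathcomp Require Import all_boot all_order all_algebra.
From mathcomp Require Import all_classical all_reals all_analysis.
From mathcomp Require Import measurable_realfun ring lra zify.
Import Order.TTheory GRing.Theory Num.Theory.
Import numFieldNormedType.Exports.

(** If the seminorm vanishes then f <= mean of f over R^+ almost everywhere on
    R^-, for every parabolic rectangle R.  Cut a cube of edge L into two halves
    along a coordinate: the integral of f over either half of R^- is at most half
    of its integral over R^+.  For the integrals u_k over consecutive slabs of
    width L/2 this reads u_k(t) <= (u_k + u_(k+1))(t + s) / 2 and
    u_(k+1)(t) <= (u_k + u_(k+1))(t + s) / 2, with a delay s of order L^p.  Summing
    against a trapezoidal weight bounds the difference of the integrals over two
    adjacent cubes of edge w by O(w/L) times the increment of a bounded quantity
    over one time step; telescoping over N ~ L^-p steps makes the average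
    difference O(L^(p-1)), which tends to 0 because p > 1.  Hence the integral of
    f over a cube does not depend on its position, and f is bounded almost
    everywhere on {t < s} by the mean of f over a unit cube times [s, s + b[, for
    all s and b.  The infimum over b of these means is a non-decreasing function of
    s, and comparing it with f on N thin time slices, where the errors telescope,
    shows that it equals f almost everywhere. *)

Set Implicit Arguments.
Unset Strict Implicit.
Unset Printing Implicit Defensive.

Local Open Scope classical_set_scope.
Local Open Scope ring_scope.

(** * Space-time boxes *)

Section boxes.
Context (R : realType) (n : nat).
Implicit Types (a b : 'I_n -> R) (s t u : R) (g : spacetime R n -> R).
Local Notation mu := (lebesgue_spacetime R n).

(** Corners are functions on ['I_n] rather than row vectors, so that [upd] can move a single face.
    Half-open sides let boxes be cut and glued without overlap. *)
Definition box a b : set 'rV[R]_n :=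
  [set y | forall i, a i <= y ord0 i < b i].

Definition cyl a b s t : set (spacetime R n) := box a b `*` `[s, t[.

Definition upd (T : Type) (a : 'I_n -> T) i c : 'I_n -> T :=
  fun j => if j == i then c else a j.

Lemma measurable_spacetime (A : set ('rV[R]_n * measurableTypeR R)) :
  measurable A -> measurable (A : set (spacetime R n)).
Proof. exact: caratheodory_measurable_mu_ext. Qed.

Lemma measurable_coord_itv (I : 'I_n -> interval R) :
  measurable [set y : 'rV[R]_n | forall i, y ord0 i \in I i].
Proof.
rewrite (_ : [set _ | _] = \bigcap_(i in [set: 'I_n])
    ((fun v : 'rV[R]_n => v ord0 i : measurableTypeR R) @^-1` [set` I i])).
  apply: fin_bigcap_measurable => // i _.
  by rewrite -[X in measurable X]setTI; exact: measurable_rV_coord.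
by apply/seteqP; split => [v h i _|v h i]; [exact: h|exact: (h i Logic.I)].
Qed.

Lemma measurable_box a b : measurable (box a b).
Proof.
rewrite (_ : box a b = [set y | forall i, y ord0 i \in `[a i, b i[%R]).
  exact: measurable_coord_itv.
by apply/seteqP; split => y h i; have := h i; rewrite in_itv.
Qed.

Lemma measurable_cyl a b s t : measurable (cyl a b s t).
Proof.
apply: measurable_spacetime; apply: measurableX => //; exact: measurable_box.
Qed.
#[local] Hint Resolve measurable_cyl : core.

Lemma lebesgue_box a b : (forall i, a i <= b i) ->
  lebesgue_rV R n (box a b) = (\prod_i (b i - a i))%:E.
Proof.
move=> ab.
have := @lebesgue_rV_box R n (\row_j a j) (\row_j b j).
under eq_bigr do rewrite !mxE.
move=> <-; last by move=> i; rewrite !mxE.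
by congr (lebesgue_rV R n _); apply/seteqP; split => y h i; have := h i; rewrite !mxE.
Qed.

Lemma lebesgue_cyl a b s t : (forall i, a i <= b i) -> s <= t ->
  mu (cyl a b s t) = ((\prod_i (b i - a i)) * (t - s))%:E.
Proof.
move=> ab st.
rewrite /lebesgue_spacetime/= /completed_measure_extension measurable_mu_extE; last first.
  apply: measurableX => //; exact: measurable_box.
rewrite /borel_spacetime/= product_measure1E//; last exact: measurable_box.
transitivity ((\prod_i (b i - a i))%:E * (@lebesgue_measure R) `[s, t[%classic)%E.
  by congr (_ * _)%E; exact: lebesgue_box.
rewrite lebesgue_measure_itv/= lte_fin EFinM.
congr (_ * _)%E; have [//|ts] := ltP s t.
suff -> : s = t by rewrite subrr.
by apply/eqP; rewrite eq_le st.
Qed.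

Definition cyl_integrable g := forall a b s t, mu.-integrable (cyl a b s t) (EFin \o g).

(** A half-open cylinder is not compact, but it lies in the closed one with the same corners, which
    is. *)
Lemma locally_integrable_cyl g : locally_integrable_spacetime g -> cyl_integrable g.
Proof.
move=> [_ ig] a b s t.
pose K : set ('rV[R]_n * R) :=
  [set y : 'rV[R]_n | forall i, y ord0 i \in `[a i, b i]] `*` `[s, t].
have mK : measurable (K : set (spacetime R n)).
  apply: measurable_spacetime; apply: measurableX => //; exact: measurable_coord_itv.
apply: (integrableS mK) => //.
  move=> [y r] [yab]; rewrite /= in_itv/= => /andP[sr rt]; split.
    by move=> i; rewrite in_itv/=; have /andP[-> /ltW ->] := yab i.
  by rewrite /= in_itv/= sr ltW.
apply: ig; apply: compact_setX; last exact: segment_compact.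
by apply: (@rV_compact _ _ (fun i => `[a i, b i]%classic)) => i; exact: segment_compact.
Qed.

Definition cint g a b s t : R := \int[mu]_(z in cyl a b s t) g z.

Lemma cyl_split_time a b s t u : s <= t <= u ->
  cyl a b s u = cyl a b s t `|` cyl a b t u.
Proof.
move=> /andP[st tu]; apply/seteqP; split => -[y r].
  move=> [yab]; rewrite /= in_itv/= => /andP[sr ru].
  by have [rt|tr] := ltP r t; [left|right]; split; rewrite //= in_itv/= ?sr ?tr.
case=> -[yab]; rewrite /= in_itv/= => /andP[r1 r2]; split; rewrite //= in_itv/=.
  by rewrite r1 (lt_le_trans r2).
by rewrite r2 (le_trans st).
Qed.

Lemma disj_cyl_time a b s t u : [disjoint cyl a b s t & cyl a b t u].
Proof.
apply/eqP; rewrite -subset0 => -[y r] [] [_] /=; rewrite !in_itv/= => /andP[_ rt].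
by move=> [_] /=; rewrite !in_itv/= leNgt rt.
Qed.

Lemma cyl_split_space a b s t i c : a i <= c <= b i ->
  cyl a b s t = cyl a (upd b i c) s t `|` cyl (upd a i c) b s t.
Proof.
move=> /andP[ac cb]; rewrite /cyl.
suff -> : box a b = box a (upd b i c) `|` box (upd a i c) b.
  by apply/seteqP; split => -[y r]; [move=> [] [] ? ?; [left|right]|
    case=> -[? ?]; split => //; [left|right]].
apply/seteqP; split => y.
  move=> yab; have [yc|cy] := ltP (y ord0 i) c; [left|right] => j; rewrite /upd.
  - by case: eqP => [->|_]; last exact: yab; rewrite yc; case/andP: (yab i) => ->.
  - by case: eqP => [->|_]; last exact: yab; rewrite cy; case/andP: (yab i) => _ ->.
case=> yab j; have := yab j; rewrite /upd; case: eqP => // -> /andP[h k].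
- by rewrite h (lt_le_trans k).
- by rewrite k (le_trans ac).
Qed.

Lemma disj_cyl_space a b s t i c : [disjoint cyl a (upd b i c) s t & cyl (upd a i c) b s t].
Proof.
apply/eqP; rewrite -subset0 => -[y r] [] [/(_ i) + _] [/(_ i) + _].
by rewrite /upd eqxx => /andP[_ yc]; rewrite leNgt yc.
Qed.

Lemma cint_time g a b s t u : cyl_integrable g -> s <= t <= u ->
  cint g a b s u = cint g a b s t + cint g a b t u.
Proof.
move=> ig stu; rewrite /cint (cyl_split_time _ _ stu) Rintegral_setU//.
- by rewrite -cyl_split_time//; exact: ig.
- exact: disj_cyl_time.
Qed.

Lemma cint_space g a b s t i c : cyl_integrable g -> a i <= c <= b i ->
  cint g a b s t = cint g a (upd b i c) s t + cint g (upd a i c) b s t.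
Proof.
move=> ig acb; rewrite /cint (cyl_split_space _ _ acb) Rintegral_setU//.
- by rewrite -cyl_split_space//; exact: ig.
- exact: disj_cyl_space.
Qed.

Lemma cintxx g a b s : cint g a b s s = 0.
Proof.
by rewrite /cint /cyl set_itvco0 setX0 Rintegral_set0.
Qed.

Lemma cyl_integrable_norm g : cyl_integrable g -> cyl_integrable (fun z => `|g z|).
Proof. by move=> ig a b s t; exact: (integrable_norm (ig a b s t)). Qed.

Lemma norm_cint g a b s t : cyl_integrable g ->
  `|cint g a b s t| <= cint (fun z => `|g z|) a b s t.
Proof. by move=> ig; apply: le_normr_Rintegral => //; exact: ig. Qed.

Lemma cint_ge0 g a b s t : (forall z, 0 <= g z) -> 0 <= cint g a b s t.
Proof. by move=> g0; apply: Rintegral_ge0. Qed.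

(** Absolute continuity of the integral: thin time slices have small measure. This is what allows
    arbitrary times to be replaced by nearby multiples of [len] and [lag]. *)
Lemma cint_small g a b t0 e : cyl_integrable g -> 0 < e ->
  exists2 d, 0 < d & forall s t, t0 - d < s -> s <= t -> t < t0 + d ->
    `|cint g a b s t| <= e.
Proof.
move=> ig e0.
(* If some side has its ends in the wrong order, the box is empty and the integral is 0. *)
wlog ab : / forall i, a i <= b i.
  move=> h; have [|nab] := pselect (forall i, a i <= b i); first exact: h.
  exists 1 => // s t _ _ _.
  rewrite /cint (_ : cyl a b s t = set0) ?Rintegral_set0 ?normr0 ?ltW//.
  rewrite -subset0 => -[y r] [yab _]; apply: nab => i.
  by have /andP[h1 /ltW h2] := yab i; exact: le_trans h2.
(* Absolute continuity is applied to an integrable function on the whole space, hence the cut-off of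
   [g] to a bounded cylinder containing all the slices considered. *)
pose D := cyl a b (t0 - 1) (t0 + 1).
have iD : mu.-integrable setT (EFin \o (g \_ D)).
  rewrite -restrict_EFin; by apply/(integrable_mkcond _ (measurable_cyl _ _ _ _)); exact: ig.
have [d [d0 hd]] := integral_normr_continuous iD e0.
pose v := \prod_i (b i - a i).
have v0 : 0 <= v by apply: prodr_ge0 => i _; rewrite subr_ge0.
(* The bound 1 keeps the slice inside [D]. The other bound gives [t - s < d / (v + 1)], so the slice
   has measure less than [d]; [v + 1] replaces [v], which may be 0. *)
exists (Num.min 1 (d / (2 * (v + 1)))).
  by rewrite lt_min ltr01/= divr_gt0// mulr_gt0// ltr_wpDl.
move=> s t s0 st t1.
have sub : cyl a b s t `<=` D.
  move=> [y r] [yab]; rewrite /= !in_itv/= => /andP[sr rt]; split => //=.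
  rewrite in_itv/=.
  have : Num.min 1 (d / (2 * (v + 1))) <= 1 by rewrite ge_min lexx.
  move: s0 t1; set m := Num.min _ _ => s0 t1 m1.
  by clear -s0 t1 m1 sr rt; apply/andP; split; lra.
apply: (le_trans (norm_cint _ _ _ _ ig)).
have -> : cint (fun z => `|g z|) a b s t = \int[mu]_(z in cyl a b s t) `|(g \_ D) z|.
  apply: eq_Rintegral => z; rewrite inE => zc; rewrite patchE mem_set//; exact: sub.
apply/ltW/hd => //.
rewrite lebesgue_cyl// lte_fin -/v.
have : t - s < d / (v + 1).
  have : Num.min 1 (d / (2 * (v + 1))) <= d / (2 * (v + 1)) by rewrite ge_min lexx orbT.
  have : d / (2 * (v + 1)) = d / (v + 1) / 2 by field; lra.
  by move: s0 t1; set m := Num.min _ _; set q := d / (v + 1); lra.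
rewrite ltr_pdivlMr; last by lra.
by nra.
Qed.

End boxes.

(** * Essential upper bounds *)

Section ae_bounds.
Context (R : realType) (n : nat).
Implicit Types (a b : 'I_n -> R) (s t u r L c : R) (g f : spacetime R n -> R).
Local Notation mu := (lebesgue_spacetime R n).

Definition ae_le f c (A : set (spacetime R n)) := {ae mu, forall z, A z -> f z <= c}.

Lemma ae_leS f c (A B : set (spacetime R n)) : A `<=` B -> ae_le f c B -> ae_le f c A.
Proof. by move=> AB; rewrite /ae_le; apply: filterS => z h /AB. Qed.

Lemma ae_leW f c d (A : set (spacetime R n)) : c <= d -> ae_le f c A -> ae_le f d A.
Proof. by move=> cd; rewrite /ae_le; apply: filterS => z h /h h1; exact: le_trans cd. Qed.

Lemma cint_ae_le f a b s t c : cyl_integrable f -> (forall i, a i <= b i) -> s <= t ->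
  ae_le f c (cyl a b s t) -> cint f a b s t <= c * ((\prod_i (b i - a i)) * (t - s)).
Proof.
move=> intf ab st fc.
have mc := measurable_cyl a b s t.
have ic : mu.-integrable (cyl a b s t) (EFin \o cst c).
  apply: measurable_bounded_integrable => //.
    by rewrite [X in (X < _)%E]lebesgue_cyl ?ltry.
  by exists `|c|; split => [|x cx z _ /=]; [exact: num_real|exact: ltW].
have -> : c * ((\prod_i (b i - a i)) * (t - s)) = \int[mu]_(z in cyl a b s t) c.
  by rewrite Rintegral_cst// lebesgue_cyl.
rewrite -subr_ge0 -[X in _ - X]/(\int[mu]_(z in cyl a b s t) f z) -RintegralB//.
(* The difference [c - f] agrees almost everywhere with [|c - f|], which is nonnegative at every
   point. *)
rewrite /Rintegral (@ae_eq_integral _ _ _ _ _ (fun z => (`|c - f z|)%:E)).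
- by rewrite fine_ge0// integral_ge0.
- exact: mc.
- have := integrableB mc ic (intf a b s t); exact: measurable_int.
- have := integrable_norm (integrableB mc ic (intf a b s t)); exact: measurable_int.
- move: fc; rewrite /ae_le; apply: filterS => z h /h {}h.
  by congr EFin; rewrite ger0_norm ?subr_ge0.
Qed.

Variables (p gamma : R).
Hypotheses (gamma0 : 0 < gamma) (gamma1 : gamma < 1).

(** For a parabolic rectangle of edge [L], [parabolic_len] is the duration of both R^-(gamma) and
    R^+(gamma), and [parabolic_lag] is the delay from the start of the former to the start of the
    latter. *)
Definition parabolic_len L := (1 - gamma) * L `^ p.
Definition parabolic_lag L := (1 + gamma) * L `^ p.

Lemma len_gt0 L : 0 < L -> 0 < parabolic_len L.
Proof. by move=> L0; rewrite mulr_gt0 ?powR_gt0// subr_gt0. Qed.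

Lemma lag_gt0 L : 0 < L -> 0 < parabolic_lag L.
Proof. by move=> L0; rewrite mulr_gt0 ?powR_gt0 ?addr_gt0. Qed.

Lemma lebesgue_cube a r L l : 0 < L -> 0 <= l ->
  mu (cyl a (fun i => a i + L) r (r + l)) = (L ^+ n * l)%:E.
Proof.
move=> L0 l0; rewrite lebesgue_cyl; last 2 first.
- by move=> i; lra.
- by lra.
congr (_ * _)%:E; last by lra.
under eq_bigr do rewrite addrC addKr.
by rewrite prodr_const card_ord.
Qed.

Lemma mean_cyl f a b s t : cyl_integrable f ->
  fine (mean (cyl a b s t) f) = (fine (mu (cyl a b s t)))^-1 * cint f a b s t.
Proof.
move=> intf; rewrite /mean fineM//=.
apply: integrable_fin_num => //; exact: measurable_cyl.
Qed.

(** A nonnegative function with integral 0 vanishes almost everywhere; here it is the positive part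
    of [f] minus its mean over R^+. The rectangle is described by the lower corner [(a, r)] of R^-
    instead of by its centre. *)
Lemma BMOplus_norm0_ae_le f a r L : cyl_integrable f ->
  BMOplus_norm p gamma f = 0%E -> 0 < L ->
  ae_le f (cint f a (fun i => a i + L) (r + parabolic_lag L)
    (r + parabolic_lag L + parabolic_len L)
      / (L ^+ n * parabolic_len L))
    (cyl a (fun i => a i + L) r (r + parabolic_len L)).
Proof.
move=> intf norm0 L0; have l0 := len_gt0 L0.
pose Q := ParabolicRectangle (\row_i (a i + L / 2)) (r + L `^ p) L0.
have [QE1 QE2] : (fun i => center_x Q ord0 i - edge Q / 2) = a /\
    (fun i => center_x Q ord0 i + edge Q / 2) = (fun i => a i + L).
  by split; apply/funext => i; rewrite /= mxE; lra.
have lowE : lower_part p gamma Q = cyl a (fun i => a i + L) r (r + parabolic_len L).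
  transitivity (cyl (fun i => center_x Q ord0 i - edge Q / 2)
    (fun i => center_x Q ord0 i + edge Q / 2)
    (r + L `^ p - L `^ p) (r + L `^ p - gamma * L `^ p)).
    by [].
  by rewrite QE1 QE2; congr cyl; rewrite /parabolic_len; lra.
have upE : upper_part p gamma Q =
    cyl a (fun i => a i + L) (r + parabolic_lag L) (r + parabolic_lag L + parabolic_len L).
  transitivity (cyl (fun i => center_x Q ord0 i - edge Q / 2)
    (fun i => center_x Q ord0 i + edge Q / 2)
    (r + L `^ p + gamma * L `^ p) (r + L `^ p + L `^ p)).
    by [].
  by rewrite QE1 QE2; congr cyl; rewrite /parabolic_len /parabolic_lag; lra.
have : (mean (lower_part p gamma Q)
      (fun z => Num.max (f z - fine (mean (upper_part p gamma Q) f)) 0)%R <= 0)%E.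
  by rewrite -norm0; apply: ereal_sup_ubound; exists Q.
rewrite lowE upE mean_cyl// (lebesgue_cube _ _ L0 (ltW l0))/=.
rewrite -[cint _ _ _ _ _ / _]mulrC; set m := _ * _ => h.
set A := cyl _ _ _ _ in h *.
have muA : mu A = (L ^+ n * parabolic_len L)%:E by apply: lebesgue_cube => //; exact: ltW.
rewrite /mean muA/= in h.
have mA : measurable A by exact: measurable_cyl.
have : (\int[mu]_(z in A) `|(Num.max (f z - m) 0)%R%:E| = 0)%E.
  apply/eqP; rewrite eq_le integral_ge0 ?andbT//.
  rewrite (eq_integral (fun z => (Num.max (f z - m) 0)%R%:E)); last first.
    by move=> z _; rewrite /= ger0_norm// le_max lexx orbT.
  by move: h; rewrite pmule_rle0// lte_fin invr_gt0 mulr_gt0 ?exprn_gt0.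
move/(ae_eq_integral_abs mu mA) => [].
  apply/measurable_EFinP; apply: measurable_maxr; last exact: measurable_cst.
  apply: measurable_funB; last exact: measurable_cst.
  apply/measurable_EFinP; have := intf a (fun i => a i + L) r (r + parabolic_len L).
  exact: measurable_int.
move=> N [mN N0 sub]; exists N; split => //.
apply: subset_trans sub => z /=; apply: contra_not => hz zA.
have := hz zA => -[] /eqP; rewrite eq_le ge_max subr_le0 => /andP[/andP[+ _] _].
by [].
Qed.

End ae_bounds.

(** * Half cubes and slabs *)

Section lattice.
Context (n : nat).

(** Induction over integer boxes: each is glued from unit cells along hyperplanes. A layer of
    thickness one is cut off along a side longer than one, which lowers the sum of the side lengths
    of both pieces. *)
Lemma tile_ind (P : ('I_n -> nat) -> ('I_n -> nat) -> Prop) :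
  (forall k, P k (fun i => (k i).+1)) ->
  (forall k m i c, (k i < c < m i)%N -> P k (upd m i c) -> P (upd k i c) m -> P k m) ->
  forall k m, (forall i, (k i < m i)%N) -> P k m.
Proof.
move=> P1 Psplit k m.
have [N] := ubnP (\sum_i (m i - k i))%N.
elim: N k m => // N IH k m sN km.
have [[i ki]|h] := pselect (exists i, ((k i).+1 < m i)%N); last first.
  suff -> : m = (fun i => (k i).+1) by exact: P1.
  apply/funext => i; apply/eqP; rewrite eqn_leq km andbT leqNgt.
  by apply/negP => ki; apply: h; exists i.
have sE (k' m' : 'I_n -> nat) : (m' i - k' i < m i - k i)%N ->
    (forall j, j != i -> m' j = m j /\ k' j = k j) ->
    (\sum_j (m' j - k' j) < N)%N.
  move=> lt e; rewrite -ltnS; apply: leq_trans sN; rewrite ltnS.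
  rewrite (bigD1 i)//= [X in (_ < X)%N](bigD1 i)//= -addSn leq_add//.
  by apply: leq_sum => j /e[-> ->].
apply: (Psplit k m i (k i).+1); first by rewrite ltnSn.
- apply: IH.
    by apply: sE => [|j /negPf ji]; rewrite /upd ?eqxx ?ji// subSnn ltn_subRL addn1.
  by move=> j; rewrite /upd; case: eqP => [->|_]; last exact: km.
- apply: IH.
    apply: sE => [|j /negPf ji]; rewrite /upd ?eqxx ?ji//.
    by rewrite subnS prednK// subn_gt0.
  by move=> j; rewrite /upd; case: eqP => [->|_]; last exact: km.
Qed.

Definition lattice (R : realType) (a : 'I_n -> R) L (k : 'I_n -> nat) : 'I_n -> R :=
  fun i => a i + L * (k i)%:R.

Lemma upd_id (T : Type) (a : 'I_n -> T) i : upd a i (a i) = a.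
Proof. by apply/funext => j; rewrite /upd; case: eqP => // ->. Qed.

Lemma upd_eq (T : Type) (a : 'I_n -> T) i c : upd a i c i = c.
Proof. by rewrite /upd eqxx. Qed.

Lemma upd_upd (T : Type) (a : 'I_n -> T) i c d : upd (upd a i c) i d = upd a i d.
Proof. by apply/funext => j; rewrite /upd; case: eqP. Qed.

Lemma updC (T : Type) (a : 'I_n -> T) i j c d : i != j ->
  upd (upd a i c) j d = upd (upd a j d) i c.
Proof.
move=> ij; apply/funext => l; rewrite /upd.
by case: (eqVneq l j) => [->|//]; rewrite eq_sym (negPf ij).
Qed.

Lemma lattice_upd (R : realType) (a : 'I_n -> R) L k i c :
  lattice a L (upd k i c) = upd (lattice a L k) i (a i + L * c%:R).
Proof. by apply/funext => j; rewrite /lattice /upd; case: eqP => // ->. Qed.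

End lattice.

(** * Comparison of half cubes with whole cubes at a later time *)

Section transport.
Context (R : realType) (n : nat) (p gamma : R).
Hypotheses (gamma0 : 0 < gamma) (gamma1 : gamma < 1).
Variable f : spacetime R n -> R.
Hypotheses (intf : cyl_integrable f) (norm0 : BMOplus_norm p gamma f = 0%E).
Implicit Types (a b : 'I_n -> R) (r L th : R).
Local Notation len := (parabolic_len p gamma).
Local Notation lag := (parabolic_lag p gamma).

(** Almost everywhere on R^-, [f] is at most its mean over R^+, and a piece of width [L / 2] along
    [e] has half the volume. The parameter [th] places the piece: 0 gives the left half and 1/2 the
    right half. *)
Lemma cint_half_cube a r L e th : 0 < L -> 0 <= th <= 1 / 2 ->
  cint f (upd a e (a e + th * L)) (upd (fun i => a i + L) e (a e + th * L + L / 2))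
    r (r + len L)
  <= cint f a (fun i => a i + L) (r + lag L) (r + lag L + len L) / 2.
Proof.
move=> L0 /andP[th0 th1]; have l0 := len_gt0 p gamma1 L0.
set a' := upd _ _ _; set b' := upd _ _ _.
have thL0 : 0 <= th * L by apply: mulr_ge0 => //; exact: ltW.
have thL1 : th * L <= L / 2 by nra.
have sub : cyl a' b' r (r + len L) `<=` cyl a (fun i => a i + L) r (r + len L).
  move=> [y s] [yab ys]; split => // i; have := yab i; rewrite /a' /b' /upd.
  by case: eqP => // -> /andP[h1 h2]; apply/andP; split; lra.
have := ae_leS sub (BMOplus_norm0_ae_le gamma1 a r intf norm0 L0).
set V := cint _ _ _ (r + lag L) _.
move=> /(cint_ae_le intf); rewrite lerDl (ltW l0) => /(_ _ isT) h.
apply: le_trans (h _) _.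
  by move=> i; rewrite /a' /b' /upd; case: eqP => _; lra.
rewrite [r + _]addrC addrK.
have -> : \prod_i (b' i - a' i) = L ^+ n / 2.
  transitivity ((\prod_(i < n) L) / 2); last by rewrite prodr_const card_ord.
  rewrite (bigD1 e)//= [in RHS](bigD1 e)//= {1}/a' {1}/b' /upd eqxx.
  rewrite [X in _ * X](eq_bigr (fun=> L)); first by ring.
  by move=> i /negPf ie; rewrite /a' /b' /upd ie; ring.
rewrite le_eqVlt; apply/orP; left; apply/eqP.
by field; rewrite !gt_eqF// exprn_gt0.
Qed.

(** The inequality for single cubes is summed over the cells of a box that is one cell thick along
    [e]. *)
Lemma cint_half_box a r L e th k m : 0 < L -> 0 <= th <= 1 / 2 ->
  (forall i, (k i < m i)%N) -> m e = (k e).+1 ->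
  cint f (upd (lattice a L k) e (lattice a L k e + th * L))
    (upd (lattice a L m) e (lattice a L k e + th * L + L / 2)) r (r + len L)
  <= cint f (lattice a L k) (lattice a L m) (r + lag L) (r + lag L + len L) / 2.
Proof.
move=> L0 th01; move: k m; apply: tile_ind => [k _|k m i c /andP[kc cm] h1 h2 mke].
  have -> : lattice a L (fun i => (k i).+1) = (fun i => lattice a L k i + L).
    by apply/funext => i; rewrite /lattice mulrSr; ring.
  exact: cint_half_cube.
(* Since the box is one cell thick along [e], the cut is made along another coordinate and commutes
   with the halving. *)
have ei : e != i.
  apply/eqP => ei; move: kc cm; rewrite -ei mke [(c < _)%N]ltnS => kc.
  by rewrite leqNgt kc.
have cA : lattice a L k i <= a i + L * c%:R <= lattice a L m i.
  by rewrite /lattice !lerD2l !ler_pM2l// !ler_nat (ltnW kc) (ltnW cm).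
rewrite (cint_space _ _ intf cA).
rewrite (@cint_space _ _ _ _ _ _ _ i (a i + L * c%:R) intf); last first.
  by rewrite /upd eq_sym (negPf ei).
rewrite updC// [in X in _ + X]updC// mulrDl lerD//.
- have := h1; rewrite lattice_upd; apply.
  by rewrite /upd (negPf ei).
- have := h2; rewrite lattice_upd /upd (negPf ei); exact.
Qed.

Lemma cint_half_box_time a r L e th k m j : 0 < L -> 0 <= th <= 1 / 2 ->
  (forall i, (k i < m i)%N) -> m e = (k e).+1 ->
  cint f (upd (lattice a L k) e (lattice a L k e + th * L))
    (upd (lattice a L m) e (lattice a L k e + th * L + L / 2)) r (r + len L * j%:R)
  <= cint f (lattice a L k) (lattice a L m) (r + lag L) (r + lag L + len L * j%:R) / 2.
Proof.
move=> L0 th01 km mke; have l0 := len_gt0 p gamma1 L0.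
elim: j => [|j IH]; first by rewrite mulr0 !addr0 !cintxx mul0r.
have lj : 0 <= len L * j%:R by rewrite mulr_ge0// ltW.
rewrite (_ : j.+1%:R = j%:R + 1); last by rewrite natr1.
rewrite (@cint_time _ _ _ _ _ r (r + len L * j%:R))//; last by apply/andP; split; lra.
rewrite (@cint_time _ _ _ _ _ (r + lag L) (r + lag L + len L * j%:R))//;
  last by apply/andP; split; lra.
rewrite mulrDl lerD//.
have := cint_half_box a (r + len L * j%:R) L0 th01 km mke.
rewrite (_ : r + len L * j%:R + len L = r + len L * (j%:R + 1)); last by ring.
rewrite (_ : r + len L * j%:R + lag L = r + lag L + len L * j%:R); last by ring.
rewrite (_ : r + lag L + len L * j%:R + len L = r + lag L + len L * (j%:R + 1)) //.
by ring.
Qed.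

(** Only the coordinates other than [e] are taken from the cube of edge [w] at [a]; along [e] the
    interval from [x] to [y] is free and may leave that cube. *)
Definition slab a w e x y r s := cint f (upd a e x) (upd (fun i => a i + w) e y) r s.

Lemma slab_half a r L e th M j x : 0 < L -> 0 <= th <= 1 / 2 -> (0 < M)%N ->
  slab a (L * M%:R) e (x + th * L) (x + th * L + L / 2) r (r + len L * j%:R)
  <= slab a (L * M%:R) e x (x + L) (r + lag L) (r + lag L + len L * j%:R) / 2.
Proof.
move=> L0 th01 M0.
have := @cint_half_box_time (upd a e x) r L e th (fun=> 0%N) (upd (fun=> M) e 1%N) j L0 th01.
have -> : lattice (upd a e x) L (fun=> 0%N) = upd a e x.
  by apply/funext => i; rewrite /lattice mulr0 addr0.
have -> : lattice (upd a e x) L (upd (fun=> M) e 1%N) =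
    upd (fun i => a i + L * M%:R) e (x + L).
  by apply/funext => i; rewrite /lattice /upd; case: eqP; rewrite ?mulr1.
rewrite !upd_upd !upd_eq; apply => // i.
by rewrite /upd; case: eqP.
Qed.

End transport.

(** * Averaging in time *)

(* Summation by parts against the weight [psi], which increases with slope 1 up to
   [M] and then decreases with slope -1. *)
Lemma trapezoid_sum (R : realType) (u : nat -> nat -> R) (M N : nat) (K : R) :
  (forall k i, (k < M + M)%N -> (i < N)%N -> u k i <= (u k i.+1 + u k.+1 i.+1) / 2) ->
  (forall i, (i <= N)%N -> \sum_(0 <= k < M + M) `|u k i| <= K) ->
  \sum_(0 <= i < N) (\sum_(0 <= k < M) u k i.+1 - \sum_(M <= k < M + M) u k i.+1)
    <= 4 * M%:R * K.
Proof.
move=> hu hK.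
pose psi k := minn k (M + M - k).
pose Phi i := \sum_(0 <= k < M + M) (psi k.+1)%:R * u k i.
have step i : (i < N)%N ->
    \sum_(0 <= k < M) u k i.+1 - \sum_(M <= k < M + M) u k i.+1 <=
    2 * (Phi i.+1 - Phi i).
  move=> iN.
  have h1 : Phi i <= \sum_(0 <= k < M + M) (psi k.+1)%:R * ((u k i.+1 + u k.+1 i.+1) / 2).
    apply: ler_sum_nat => k /andP[_ kM]; apply: ler_wpM2l; first exact: ler0n.
    exact: hu.
  (* The weight vanishes at 0 and at [M + M], so the shift of index leaves no boundary term. *)
  have h2 : \sum_(0 <= k < M + M) (psi k.+1)%:R * u k.+1 i.+1 =
            \sum_(0 <= k < M + M) (psi k)%:R * u k i.+1.
    have := @big_nat_recl R 0 +%R (M + M) 0 (fun k => (psi k)%:R * u k i.+1) (leq0n _).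
    have psi0 : psi 0%N = 0%N by rewrite /psi min0n.
    have psiM : psi (M + M)%N = 0%N by rewrite /psi subnn minn0.
    rewrite big_nat_recr//= psi0 psiM !mul0r addr0 add0r.
    by move=> ->.
  have h3 : \sum_(0 <= k < M + M) (psi k.+1)%:R * ((u k i.+1 + u k.+1 i.+1) / 2) =
            (Phi i.+1 + \sum_(0 <= k < M + M) (psi k)%:R * u k i.+1) / 2.
    rewrite -h2 /Phi -big_split/= mulr_suml; apply: eq_bigr => k _.
    by rewrite mulrA -mulrDr.
  (* The increments of the weight are 1 on the first half and -1 on the second, which yields exactly
     the difference to be bounded. *)
  have h4 : Phi i.+1 - \sum_(0 <= k < M + M) (psi k)%:R * u k i.+1 =
      \sum_(0 <= k < M) u k i.+1 - \sum_(M <= k < M + M) u k i.+1.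
    rewrite /Phi -sumrB (@big_cat_nat _ _ _ M)/= ?leq_addr//; congr (_ + _).
      apply: eq_big_nat => k /andP[_ kM]; rewrite -mulrBl.
      have -> : psi k.+1 = (psi k).+1 by rewrite /psi; lia.
      by rewrite mulrSr addrC addKr mul1r.
    rewrite -sumrN; apply: eq_big_nat => k /andP[Mk kM]; rewrite -mulrBl.
    have -> : psi k = (psi k.+1).+1 by rewrite /psi; lia.
    by rewrite mulrSr opprD addrA subrr add0r mulN1r.
  by rewrite h3 in h1; rewrite -h4; lra.
have PhiK i : (i <= N)%N -> `|Phi i| <= M%:R * K.
  move=> iN; apply: (le_trans (ler_norm_sum _ _ _)).
  apply: (@le_trans _ _ (M%:R * \sum_(0 <= k < M + M) `|u k i|)); last first.
    by apply: ler_wpM2l; [exact: ler0n|exact: hK].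
  rewrite mulr_sumr; apply: ler_sum_nat => k _; rewrite normrM ger0_norm//.
  by apply: ler_wpM2r => //; rewrite ler_nat /psi; lia.
apply: (@le_trans _ _ (\sum_(0 <= i < N) 2 * (Phi i.+1 - Phi i))).
  by apply: ler_sum_nat => i /andP[_]; exact: step.
rewrite -mulr_sumr telescope_sumr//.
have := PhiK _ (leqnn N); have := PhiK _ (leq0n N).
by rewrite !ler_norml => /andP[? ?] /andP[? ?]; lra.
Qed.

Section time_average.
Context (R : realType) (p gamma : R).
Hypotheses (p1 : 1 < p) (gamma0 : 0 < gamma) (gamma1 : gamma < 1).
Local Notation len := (parabolic_len p gamma).
Local Notation lag := (parabolic_lag p gamma).

Lemma len_le_lag L : len L <= lag L.
Proof. by apply: ler_wpM2r; [exact: powR_ge0|move: gamma0; lra]. Qed.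

(** This is where [p > 1] enters: [M * lag (w / M)] equals [w (1 + gamma) (w / M)^(p - 1)], which
    tends to 0 as [M] grows. *)
Lemma exists_scale w e : 0 < w -> 0 < e ->
  exists2 M, (0 < M)%N & M%:R * lag (w / M%:R) <= e.
Proof.
move=> w0 e0.
have g0 : 0 < 1 + gamma by rewrite addr_gt0.
(* The edge at which [w (1 + gamma) c^(p - 1)] equals [e]; any smaller edge will do. *)
pose c := (e / (w * (1 + gamma))) `^ (p - 1)^-1.
have c0 : 0 < c by rewrite powR_gt0// divr_gt0// mulr_gt0.
exists (Num.truncn (w / c)).+1 => //.
set M := (Num.truncn _).+1.
have M0 : 0 < M%:R :> R by rewrite ltr0n.
have wM : 0 < w / M%:R by rewrite divr_gt0.
have wMc : w / M%:R <= c.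
  rewrite ler_pdivrMr// mulrC -ler_pdivrMr//.
  by have /andP[_ /ltW] := truncn_itv (ltW (divr_gt0 w0 c0)).
have -> : (M%:R * lag (w / M%:R)) = w * (1 + gamma) * (w / M%:R) `^ (p - 1).
  have pE : (w / M%:R) `^ p = (w / M%:R) `^ (p - 1) * (w / M%:R).
    rewrite -[in LHS](subrK 1 p) [LHS]powRD ?powRr1 ?(ltW wM)//.
    by apply/implyP => _; rewrite gt_eqF.
  by rewrite /parabolic_lag pE; field; rewrite gt_eqF.
have : (w / M%:R) `^ (p - 1) <= c `^ (p - 1).
  by apply: ge0_ler_powR => //; rewrite ?nnegrE ?subr_ge0 ltW.
rewrite /c -powRrM mulVf ?powRr1; last 2 first.
- by rewrite ltW// divr_gt0// mulr_gt0.
- by rewrite gt_eqF// subr_gt0.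
by rewrite ler_pdivlMr ?mulr_gt0// [X in X <= _]mulrC.
Qed.

(* The sum of [N] shifts is only of order [M], whereas [N] can be taken of order
   [M ^ p] with [p > 1]. *)
Lemma time_average_le0 (X : R -> R -> R) (r b w K : R) :
  (forall s t u, s <= t <= u -> X s u = X s t + X t u) ->
  (forall t0 e : R, 0 < e -> exists2 d : R, 0 < d &
    forall s t : R, t0 - d < s -> s <= t -> t < t0 + d ->
    `|X s t| <= e) ->
  0 < w -> 0 <= b -> 0 <= K ->
  (forall M N j, (0 < M)%N -> lag (w / M%:R) * N%:R + len (w / M%:R) * j%:R <= b + 1 ->
    \sum_(0 <= i < N) X (r + lag (w / M%:R) * i.+1%:R)
      (r + lag (w / M%:R) * i.+1%:R + len (w / M%:R) * j%:R) <= M%:R * K) ->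
  X r (r + b) <= 0.
Proof.
move=> addX smallX w0 b0 K0 hX.
apply/ler_addgt0Pl => e3; rewrite ?addr0 => e30; pose e := e3 / 3.
have e0 : 0 < e by rewrite divr_gt0.
have [d1 d10 hd1] := smallX r _ e0.
have [d2 d20 hd2] := smallX (r + b) _ e0.
pose d := Num.min 1 (Num.min d1 d2).
have d0 : 0 < d by rewrite !lt_min ltr01 d10.
have [dle1 dled1 dled2] : [/\ d <= 1, d <= d1 & d <= d2].
  by split; rewrite /d !ge_min lexx ?orbT.
have [] := @exists_scale w (Num.min (d / 4) (e * d / (4 * (K + 1)))) w0.
  rewrite lt_min; apply/andP; split; apply: divr_gt0 => //.
    by rewrite mulr_gt0.
  by rewrite mulr_gt0// ltr_wpDl.
move=> M M0; set lg := lag _; pose ln := len (w / M%:R).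
have M1 : 1 <= M%:R :> R by rewrite ler1n.
have wM0 : 0 < w / M%:R by rewrite divr_gt0// ltr0n.
have lg0 : 0 < lg by exact: lag_gt0.
have ln0 : 0 < ln by exact: len_gt0.
have lnlg : ln <= lg := len_le_lag _.
rewrite le_min => /andP[lgd lgK].
have lgd' : lg <= d / 4 by apply: le_trans lgd; rewrite ler_peMl// ltW.
(* The [N] lags together last between [d / 4] and [d / 2], and [j] steps of duration [ln] fill [b]
   up to a remainder smaller than [ln]. *)
pose N := Num.truncn (d / 2 / lg); pose j := Num.truncn (b / ln).
have /andP[N1 N2] : N%:R <= d / 2 / lg < N.+1%:R.
  by apply: truncn_itv; apply: divr_ge0; [apply: divr_ge0 => //|]; exact: ltW.
have /andP[j1 j2] : j%:R <= b / ln < j.+1%:R.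
  by apply: truncn_itv; apply: divr_ge0 => //; exact: ltW.
rewrite ler_pdivlMr// [X in X <= _]mulrC in N1; rewrite ltr_pdivrMr// [X in _ < X]mulrC in N2.
rewrite ler_pdivlMr// [X in X <= _]mulrC in j1; rewrite ltr_pdivrMr// [X in _ < X]mulrC in j2.
rewrite -(natr1 N) mulrDr mulr1 in N2; rewrite -(natr1 j) mulrDr mulr1 in j2.
have N0 : 0 < N%:R :> R.
  have : 0 < lg * N%:R by lra.
  by rewrite pmulr_rgt0.
have hsum : lg * N%:R + ln * j%:R <= b + 1 by lra.
have := hX M N j M0 hsum; rewrite -/lg -/ln => hs.
clearbody lg ln N j d.
(* The shifted window differs from the one from [r] to [r + b] only near its two ends, and each end
   contributes at most [e]. *)
have each i : (i < N)%N ->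
    X r (r + b) - 2 * e <= X (r + lg * i.+1%:R) (r + lg * i.+1%:R + ln * j%:R).
  move=> iN; clear -addX hd1 hd2 b0 d0 dled1 dled2 N1 j1 j2 lnlg lgd' lg0 ln0 iN.
  set s := r + lg * _; set t := s + _.
  have rs : r <= s by rewrite lerDl; apply: mulr_ge0 => //; exact: ltW.
  have s1 : s <= r + d / 2.
    by rewrite lerD2l; apply: le_trans N1; rewrite ler_pM2l// ler_nat.
  have st : s <= t by rewrite lerDl; apply: mulr_ge0 => //; exact: ltW.
  have t1 : t <= r + b + d / 2 by rewrite /t; lra.
  have t2 : r + b - ln < t by rewrite /t; lra.
  have hrs : `|X r s| <= e by apply: hd1 => //; lra.
  have ert : X r t = X r s + X s t by apply: addX; rewrite rs.
  move: hrs; rewrite ler_norml => /andP[? ?].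
  have [tb|bt] := leP t (r + b).
    have : `|X t (r + b)| <= e by apply: hd2 => //; lra.
    have : X r (r + b) = X r t + X t (r + b) by apply: addX; rewrite tb andbT (le_trans rs).
    by rewrite ler_norml => ? /andP[? ?]; lra.
  have : `|X (r + b) t| <= e by apply: hd2; lra.
  have : X r t = X r (r + b) + X (r + b) t by apply: addX; apply/andP; split; lra.
  by rewrite ler_norml => ? /andP[? ?]; lra.
have : N%:R * (X r (r + b) - 2 * e) <= M%:R * K.
  apply: le_trans hs.
  have -> : N%:R * (X r (r + b) - 2 * e) = \sum_(0 <= i < N) (X r (r + b) - 2 * e).
    by rewrite sumr_const_nat subn0 mulr_natl.
  by apply: ler_sum_nat => i /andP[_]; exact: each.
(* The choice of scale gives [M * lg * (K + 1) <= e * d / 4], while [lg * N] is at least [d / 4].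
   After division by [N], [X r (r + b)] is at most [3 e]. *)
have : M%:R * K <= N%:R * e.
  have h1 : M%:R * lg * (K + 1) <= e * (d / 4).
    move: lgK; rewrite ler_pdivlMr; last by rewrite mulr_gt0// ltr_wpDl.
    by rewrite -/lg; lra.
  have h2 : d / 4 <= lg * N%:R by lra.
  rewrite -(ler_pM2l lg0); apply: (@le_trans _ _ (e * (d / 4))).
    apply: le_trans h1; rewrite mulrCA mulrA ler_pM2l; first by lra.
    by rewrite mulr_gt0// ltr0n.
  by rewrite [X in _ <= X]mulrA [X in _ <= X]mulrC ler_pM2l.
move=> h1 h2.
have : N%:R * (X r (r + b) - 2 * e) <= N%:R * e by exact: le_trans h1.
by rewrite ler_pM2l// /e; lra.
Qed.

End time_average.

(** * Invariance under spatial translations *)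

Section slab_sums.
Context (R : realType) (n : nat).
Variables (g : spacetime R n -> R) (a : 'I_n -> R) (w : R) (e : 'I_n).
Hypothesis intg : cyl_integrable g.
Implicit Types x y r s h : R.
Local Notation S := (slab g a w e).

Lemma slab_cat x y (z : R) r s : x <= y <= z -> S x z r s = S x y r s + S y z r s.
Proof.
move=> xyz; rewrite /slab (@cint_space _ _ _ _ _ _ _ e y intg) ?upd_eq//.
by rewrite !upd_upd.
Qed.

Lemma slab_time x y r s t : r <= s <= t -> S x y r t = S x y r s + S x y s t.
Proof. exact: cint_time. Qed.

Lemma sum_slab x h m1 m2 r s : 0 <= h -> (m1 <= m2)%N ->
  \sum_(m1 <= k < m2) S (x + h * k%:R) (x + h * k.+1%:R) r s =
  S (x + h * m1%:R) (x + h * m2%:R) r s.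
Proof.
move=> h0; elim: m2 => [|m2 IH].
  rewrite leqn0 => /eqP ->; rewrite big_geq//.
  (* Additivity at three equal points forces the integral over an empty slab to be 0. *)
  by have := @slab_cat (x + h * 0) (x + h * 0) (x + h * 0) r s; rewrite lexx => /(_ isT); lra.
rewrite leq_eqVlt => /predU1P[->|].
  rewrite big_geq//; set x1 := _ + _.
  by have := @slab_cat x1 x1 x1 r s; rewrite lexx => /(_ isT); lra.
rewrite ltnS => m12; rewrite big_nat_recr//= IH// -slab_cat//.
by rewrite !lerD2l !ler_wpM2l// ler_nat.
Qed.

(** Numbering from the right end reflects the configuration. Since [trapezoid_sum] bounds a
    difference from one side only, the opposite inequality between neighbouring cubes comes from
    this numbering. *)
Lemma sum_slab_rev y h m1 m2 r s : 0 <= h -> (m1 <= m2)%N ->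
  \sum_(m1 <= k < m2) S (y - h * k.+1%:R) (y - h * k%:R) r s =
  S (y - h * m2%:R) (y - h * m1%:R) r s.
Proof.
move=> h0; elim: m2 => [|m2 IH].
  rewrite leqn0 => /eqP ->; rewrite big_geq//.
  by have := @slab_cat (y - h * 0) (y - h * 0) (y - h * 0) r s; rewrite lexx => /(_ isT); lra.
rewrite leq_eqVlt => /predU1P[->|].
  rewrite big_geq//; set x1 := _ - _.
  by have := @slab_cat x1 x1 x1 r s; rewrite lexx => /(_ isT); lra.
rewrite ltnS => m12; rewrite big_nat_recr//= IH// addrC -slab_cat//.
by rewrite !lerD2l !lerN2 !ler_wpM2l// ler_nat.
Qed.

Lemma slab_le_time x y r s r' s' : (forall z, 0 <= g z) -> r' <= r -> r <= s -> s <= s' ->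
  S x y r s <= S x y r' s'.
Proof.
move=> g0 rr rs ss.
rewrite (@slab_time x y r' r s'); last by rewrite rr (le_trans rs).
rewrite (@slab_time x y r s s'); last by rewrite rs.
have h1 : 0 <= S x y r' r by exact: cint_ge0.
have h2 : 0 <= S x y s s' by exact: cint_ge0.
by lra.
Qed.

End slab_sums.

(** * Equality of the integrals over neighbouring cubes *)

Section translation.
Context (R : realType) (n : nat) (p gamma : R).
Hypotheses (p1 : 1 < p) (gamma0 : 0 < gamma) (gamma1 : gamma < 1).
Variable f : spacetime R n -> R.
Hypotheses (intf : cyl_integrable f) (norm0 : BMOplus_norm p gamma f = 0%E).
Implicit Types (a b : 'I_n -> R) (r L th : R).
Local Notation len := (parabolic_len p gamma).
Local Notation lag := (parabolic_lag p gamma).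

Lemma slab_small a w e x y t0 eps : 0 < eps ->
  exists2 d : R, 0 < d & forall s t : R, t0 - d < s -> s <= t -> t < t0 + d ->
    `|slab f a w e x y s t| <= eps.
Proof. exact: cint_small. Qed.

Lemma diff_slab_small a w e x y x' y' t0 eps : 0 < eps ->
  exists2 d : R, 0 < d & forall s t : R, t0 - d < s -> s <= t -> t < t0 + d ->
    `|slab f a w e x y s t - slab f a w e x' y' s t| <= eps.
Proof.
move=> e0; have e20 : 0 < eps / 2 by rewrite divr_gt0.
have [d1 d10 h1] := slab_small a w e x y t0 e20.
have [d2 d20 h2] := slab_small a w e x' y' t0 e20.
exists (Num.min d1 d2); first by rewrite lt_min d10.
move=> s t ts st std.
have [m1 m2] : Num.min d1 d2 <= d1 /\ Num.min d1 d2 <= d2 by rewrite !ge_min !lexx ?orbT.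
apply: (le_trans (ler_normB _ _)).
have := h1 s t; have := h2 s t.
set A := `|_|; set B := `|_| => hA hB.
have : A <= eps / 2 by apply: hA => //; lra.
have : B <= eps / 2 by apply: hB => //; lra.
by lra.
Qed.

(** The cases [th = 0] and [th = 1/2] of [slab_half] with cells of edge [w / M]: both halves of a
    slab are controlled by the same later slab. *)
Lemma slab_step a w r M e j x : 0 < w -> (0 < M)%N ->
  let h := w / M%:R / 2 in let ln := len (w / M%:R) in let lg := lag (w / M%:R) in
  (slab f a w e x (x + h) r (r + ln * j%:R) <=
    slab f a w e x (x + h + h) (r + lg) (r + lg + ln * j%:R) / 2) /\
  (slab f a w e (x + h) (x + h + h) r (r + ln * j%:R) <=
    slab f a w e x (x + h + h) (r + lg) (r + lg + ln * j%:R) / 2).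
Proof.
move=> w0 M0 h ln lg.
have MR0 : 0 < M%:R :> R by rewrite ltr0n.
have L0 : 0 < w / M%:R by rewrite divr_gt0.
have wE : w / M%:R * M%:R = w by rewrite divfK// gt_eqF.
have := @slab_half R n p gamma gamma1 f intf norm0 a r (w / M%:R) e (1 / 2) M j x L0.
have := @slab_half R n p gamma gamma1 f intf norm0 a r (w / M%:R) e 0 M j x L0.
rewrite !wE -/ln -/lg mul0r !addr0 -/h.
have -> : x + 1 / 2 * (w / M%:R) = x + h by rewrite /h; field; rewrite gt_eqF.
have -> : x + w / M%:R = x + h + h by rewrite /h; field; rewrite gt_eqF.
move=> h1 h2; split.
- by apply: h1 => //; apply/andP; split; lra.
- by apply: h2 => //; apply/andP; split; lra.
Qed.

Lemma slab_neighbour_eq a (w : R) e r (b : R) : 0 < w -> 0 <= b ->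
  let x := a e in
  slab f a w e x (x + w) r (r + b) = slab f a w e (x + w) (x + w + w) r (r + b).
Proof.
move=> w0 b0 x; pose y := x + w + w.
(* The extra unit of time leaves room for all the shifted windows, which end by [r + b + 1]. *)
pose K := slab (fun z => `|f z|) a w e x y r (r + (b + 1)).
have intnf := cyl_integrable_norm intf.
have K0 : 0 <= 8 * K by rewrite mulr_ge0// cint_ge0.
have addS x1 y1 x2 y2 s t u : s <= t <= u ->
    slab f a w e x1 y1 s u - slab f a w e x2 y2 s u =
    (slab f a w e x1 y1 s t - slab f a w e x2 y2 s t) +
    (slab f a w e x1 y1 t u - slab f a w e x2 y2 t u).
  by move=> stu; rewrite !(@slab_time _ _ _ _ _ _ intf _ _ s t u)//; lra.
(* The two inequalities are proved in parallel, with the difference [X] taken in both orders. *)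
apply/eqP; rewrite eq_le -subr_le0 -[X in _ && X]subr_le0; apply/andP; split;
  [pose X s t := slab f a w e x (x + w) s t - slab f a w e (x + w) y s t |
   pose X s t := slab f a w e (x + w) y s t - slab f a w e x (x + w) s t];
  rewrite -/(X r (r + b));
  apply: (@time_average_le0 R p gamma p1 gamma0 gamma1 X r b w (8 * K)) => //;
  rewrite {}/X; [exact: addS| by move=> *; exact: diff_slab_small| |
    exact: addS| by move=> *; exact: diff_slab_small|];
  move=> M N j M0; set lg := lag _; set ln := len _ => Nj;
  (have MR0 : 0 < M%:R :> R by rewrite ltr0n);
  (have L0 : 0 < w / M%:R by rewrite divr_gt0);
  (have lg0 : 0 < lg by exact: lag_gt0);
  (have ln0 : 0 < ln by exact: len_gt0);
  pose h := w / M%:R / 2;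
  (have h0 : 0 <= h by rewrite !divr_ge0// ltW);
  (have hM : h * (M + M)%:R = w by rewrite natrD /h; field; rewrite gt_eqF);
  (have hMM : h * (M + M + (M + M))%:R = w + w by rewrite natrD mulrDr hM).
(* Slabs are numbered from the left; each of the two cubes consists of [M + M] of them, so
   [trapezoid_sum] is used with [M + M] and its bound is [8 M K]. *)
- pose u k i := slab f a w e (x + h * k%:R) (x + h * k.+1%:R)
    (r + lg * i%:R) (r + lg * i%:R + ln * j%:R).
  have := @trapezoid_sum R u (M + M) N K.
  rewrite natrD (_ : 4 * (M%:R + M%:R) * K = M%:R * (8 * K)); last by ring.
  move=> hu; apply: le_trans (hu _ _).
  + rewrite le_eqVlt; apply/orP; left; apply/eqP; apply: eq_bigr => i _.
    rewrite /u !sum_slab//; last by rewrite leq_addr.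
    by rewrite hMM hM mulr0 addr0 /y addrA.
  + move=> k i _ _; have [+ _] := slab_step a (r + lg * i%:R) e j (x + h * k%:R) w0 M0.
    rewrite -/h -/ln -/lg.
    have -> : x + h * k%:R + h = x + h * k.+1%:R by rewrite -natr1; ring.
    have -> : x + h * k.+1%:R + h = x + h * k.+2%:R by rewrite -(natr1 k.+1); ring.
    have -> : r + lg * i%:R + lg = r + lg * i.+1%:R by rewrite -(natr1 i); ring.
    rewrite (@slab_cat _ _ _ _ _ _ intf (x + h * k%:R) (x + h * k.+1%:R) (x + h * k.+2%:R))//.
    by rewrite !lerD2l !ler_wpM2l// ler_nat.
  + move=> i iN.
    have iN' : lg * i%:R <= lg * N%:R by rewrite ler_pM2l// ler_nat.
    have lnj : 0 <= ln * j%:R by rewrite mulr_ge0// ltW.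
    have lgi : 0 <= lg * i%:R by rewrite mulr_ge0// ltW.
    apply: (@le_trans _ _ (\sum_(0 <= k < M + M + (M + M))
        slab (fun z => `|f z|) a w e (x + h * k%:R) (x + h * k.+1%:R) r (r + (b + 1)))).
      apply: ler_sum => k _; apply: (le_trans (norm_cint _ _ _ _ intf)).
      by apply: slab_le_time => //; lra.
    by rewrite sum_slab// hMM mulr0 addr0 /K /y addrA.
- pose u k i := slab f a w e (y - h * k.+1%:R) (y - h * k%:R)
    (r + lg * i%:R) (r + lg * i%:R + ln * j%:R).
  have := @trapezoid_sum R u (M + M) N K.
  rewrite natrD (_ : 4 * (M%:R + M%:R) * K = M%:R * (8 * K)); last by ring.
  move=> hu; apply: le_trans (hu _ _).
  + rewrite le_eqVlt; apply/orP; left; apply/eqP; apply: eq_bigr => i _.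
    rewrite /u !sum_slab_rev//; last by rewrite leq_addr.
    rewrite hMM hM mulr0 subr0 {2 4}/y addrK.
    by rewrite (_ : y - (w + w) = x)//; rewrite /y; ring.
  (* Numbered from the right, slab [k] is the right half of the pair formed with slab [k.+1], whose
     left end is [y - h * k.+2]. *)
  + move=> k i _ _; have [_] := slab_step a (r + lg * i%:R) e j (y - h * k.+2%:R) w0 M0.
    rewrite -/h -/ln -/lg.
    have -> : y - h * k.+2%:R + h = y - h * k.+1%:R by rewrite -(natr1 k.+1); ring.
    have -> : y - h * k.+1%:R + h = y - h * k%:R by rewrite -(natr1 k); ring.
    have -> : r + lg * i%:R + lg = r + lg * i.+1%:R by rewrite -(natr1 i); ring.
    rewrite (@slab_cat _ _ _ _ _ _ intf (y - h * k.+2%:R) (y - h * k.+1%:R) (y - h * k%:R)).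
      by rewrite /u; lra.
    by rewrite !lerD2l !lerN2 !ler_wpM2l// ler_nat.
  + move=> i iN.
    have iN' : lg * i%:R <= lg * N%:R by rewrite ler_pM2l// ler_nat.
    have lnj : 0 <= ln * j%:R by rewrite mulr_ge0// ltW.
    have lgi : 0 <= lg * i%:R by rewrite mulr_ge0// ltW.
    apply: (@le_trans _ _ (\sum_(0 <= k < M + M + (M + M))
        slab (fun z => `|f z|) a w e (y - h * k.+1%:R) (y - h * k%:R) r (r + (b + 1)))).
      apply: ler_sum => k _; apply: (le_trans (norm_cint _ _ _ _ intf)).
      by apply: slab_le_time => //; lra.
    by rewrite sum_slab_rev// hMM mulr0 subr0 (_ : y - (w + w) = x)//; rewrite /y; ring.
Qed.

End translation.

(** * Mass of the unit cube *)

Section unit_cube.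
Context (R : realType) (n : nat) (p gamma : R).
Hypotheses (p1 : 1 < p) (gamma0 : 0 < gamma) (gamma1 : gamma < 1).
Variable f : spacetime R n -> R.
Hypotheses (intf : cyl_integrable f) (norm0 : BMOplus_norm p gamma f = 0%E).
Local Notation len := (parabolic_len p gamma).
Local Notation lag := (parabolic_lag p gamma).

(** A walk from the cell back to the corner [a], one neighbour at a time; the induction is on the
    number of steps. *)
Lemma lattice_cube_eq (a : 'I_n -> R) (L r b : R) k : 0 < L -> 0 <= b ->
  cint f (lattice a L k) (fun i => lattice a L k i + L) r (r + b) =
  cint f a (fun i => a i + L) r (r + b).
Proof.
move=> L0 b0; have [N] := ubnP (\sum_i k i)%N; elim: N k => // N IH k kN.
have [[i ki]|k0] := pselect (exists i, (0 < k i)%N); last first.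
  suff -> : lattice a L k = a by [].
  apply/funext => i; rewrite /lattice (_ : k i = 0%N) ?mulr0 ?addr0//.
  by apply/eqP; rewrite -leqn0 leqNgt; apply/negP => ki; apply: k0; exists i.
have := IH (upd k i (k i).-1) => <-; last first.
  rewrite -ltnS; apply: leq_trans kN; rewrite ltnS.
  rewrite (bigD1 i)//= [X in (_ < X)%N](bigD1 i)//= upd_eq -addSn prednK//.
  by rewrite leq_add2l; apply: leq_sum => j /negPf ji; rewrite /upd ji.
set a' := lattice a L (upd k i (k i).-1).
have := slab_neighbour_eq p1 gamma0 gamma1 intf norm0 a' i r L0 b0.
rewrite /slab upd_id (_ : upd _ i (a' i + L) = fun j => a' j + L); last first.
  by apply/funext => j; rewrite /upd; case: eqP => // ->.
move=> ->; have a'i : a' i + L = a i + L * (k i)%:R.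
  rewrite /a' /lattice upd_eq -[in RHS](prednK ki) -natr1; ring.
congr cint; apply/funext => j; rewrite {1}/upd; case: eqP => [->|/eqP/negPf ji].
- by rewrite a'i.
- by rewrite /a' /lattice /upd ji.
- by rewrite a'i.
- by rewrite /a' /lattice /upd ji.
Qed.

Lemma lattice_box_eq (a : 'I_n -> R) (L r b : R) k m : 0 < L -> 0 <= b ->
  (forall i, (k i < m i)%N) ->
  cint f (lattice a L k) (lattice a L m) r (r + b) =
  (\prod_i ((m i)%:R - (k i)%:R)) * cint f a (fun i => a i + L) r (r + b).
Proof.
move=> L0 b0; move: k m; apply: tile_ind => [k|k m i c /andP[kc cm] h1 h2].
  rewrite big1 => [|i _]; last by rewrite -natr1 addrC addKr.
  rewrite mul1r -(lattice_cube_eq a r k L0 b0); congr cint.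
  by apply/funext => i; rewrite /lattice -natr1; ring.
have cA : lattice a L k i <= a i + L * c%:R <= lattice a L m i.
  by rewrite /lattice !lerD2l !ler_pM2l// !ler_nat (ltnW kc) (ltnW cm).
rewrite (cint_space _ _ intf cA) -!lattice_upd h1 h2 -mulrDl; congr (_ * _).
rewrite (bigD1 i)//= [X in _ + X](bigD1 i)//= [in RHS](bigD1 i)//= !upd_eq.
rewrite (eq_bigr (fun j => (m j)%:R - (k j)%:R)); last by move=> j /negPf ji; rewrite /upd ji.
rewrite [in X in _ + X](eq_bigr (fun j => (m j)%:R - (k j)%:R)); last first.
  by move=> j /negPf ji; rewrite /upd ji.
by rewrite -mulrDl; congr (_ * _); ring.
Qed.

(** By translation invariance, this function of the time interval determines the integrals of [f]
    over all the grid boxes used below. *)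
Definition unit_mass s t := cint f (fun=> 0) (fun=> 1) s t.

Lemma mass_add s t u : s <= t <= u -> unit_mass s u = unit_mass s t + unit_mass t u.
Proof. exact: cint_time. Qed.

(** The grid starts at the integer [- K], so the unit cube is itself a grid box, with indices from
    [K * M] to [K.+1 * M]. Counting cells in it and in the given box gives the ratio of the
    integrals. *)
Lemma lattice_mass (K M : nat) (r b : R) k m : (0 < M)%N -> 0 <= b ->
  (forall i, (k i < m i)%N) ->
  cint f (lattice (fun=> - K%:R) M%:R^-1 k) (lattice (fun=> - K%:R) M%:R^-1 m) r (r + b) =
  (\prod_i (((m i)%:R - (k i)%:R) / M%:R)) * unit_mass r (r + b).
Proof.
move=> M0 b0 km; have MR0 : 0 < M%:R :> R by rewrite ltr0n.
have L0 : 0 < M%:R^-1 :> R by rewrite invr_gt0.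
have kmu : forall i : 'I_n, (K * M < K.+1 * M)%N by move=> i; rewrite ltn_pmul2r.
have := lattice_box_eq (fun=> - K%:R) r L0 b0 kmu.
rewrite (_ : lattice _ _ _ = fun=> 0); last first.
  by apply/funext => i; rewrite /lattice natrM; field; rewrite gt_eqF.
rewrite (_ : lattice _ _ _ = fun=> 1); last first.
  by apply/funext => i; rewrite /lattice natrM -(natr1 K); field; rewrite gt_eqF.
rewrite -/(unit_mass r (r + b)) => ->.
rewrite lattice_box_eq// big_split/= -!mulrA; congr (_ * _).
rewrite mulrA -big_split/= big1 ?mul1r// => i _.
by rewrite !natrM -(natr1 K); field; rewrite gt_eqF.
Qed.

(** Each cell of edge [1 / M] is bounded by its own later mean, and these means coincide by
    translation invariance; the common bound passes to the finite union of cells. *)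
Lemma ae_le_box (K M : nat) (r : R) : (0 < K)%N -> (0 < M)%N ->
  ae_le f (unit_mass (r + lag M%:R^-1) (r + lag M%:R^-1 + len M%:R^-1) / len M%:R^-1)
    (cyl (fun=> - K%:R) (fun=> K%:R) r (r + len M%:R^-1)).
Proof.
move=> K0 M0; set lg := lag _; set ln := len _; have MR0 : 0 < M%:R :> R by rewrite ltr0n.
have L0 : 0 < M%:R^-1 :> R by rewrite invr_gt0.
have ln0 : 0 < ln by exact: len_gt0.
pose c := unit_mass (r + lg) (r + lg + ln) / ln.
have km : forall i : 'I_n, (0 < (K + K) * M)%N by move=> i; rewrite muln_gt0 addn_gt0 K0 M0.
have := @tile_ind n (fun k m => ae_le f c (cyl (lattice (fun=> - K%:R) M%:R^-1 k)
  (lattice (fun=> - K%:R) M%:R^-1 m) r (r + ln))) _ _ _ _ km.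
rewrite (_ : lattice _ _ (fun=> 0%N) = fun=> - K%:R); last first.
  by apply/funext => i; rewrite /lattice mulr0 addr0.
rewrite (_ : lattice _ _ (fun=> ((K + K) * M)%N) = fun=> K%:R); last first.
  by apply/funext => i; rewrite /lattice natrM natrD; field; rewrite gt_eqF.
apply.
- move=> k.
  have := BMOplus_norm0_ae_le gamma1 (lattice (fun=> - K%:R) M%:R^-1 k) r intf norm0 L0.
  rewrite -/lg -/ln.
  have -> : (fun i => lattice (fun=> - K%:R) M%:R^-1 k i + M%:R^-1) =
      lattice (fun=> - K%:R) M%:R^-1 (fun i => (k i).+1) :> ('I_n -> R).
    by apply/funext => i; rewrite /lattice -(natr1 (k i)); ring.
  rewrite lattice_mass ?(ltW ln0)//.
  rewrite (eq_bigr (fun=> M%:R^-1)); last first.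
    by move=> i _; rewrite -(natr1 (k i)) [X in X - _]addrC addrK mul1r.
  rewrite prodr_const card_ord.
  rewrite (_ : _ / _ = c)// /c; field.
  by rewrite !gt_eqF// exprn_gt0.
- move=> k m i d /andP[kd dm]; rewrite !lattice_upd => h1 h2.
  rewrite (@cyl_split_space _ _ _ _ _ _ i (- K%:R + M%:R^-1 * d%:R)); last first.
    by rewrite /lattice !lerD2l !ler_pM2l// !ler_nat (ltnW kd) (ltnW dm).
  rewrite /ae_le; move: h1 h2; rewrite /ae_le; apply: filterS2 => z h1 h2.
  by case; [exact: h1|exact: h2].
Qed.

Lemma mass_ae_le (s t c : R) A : s <= t ->
  cyl (fun=> -1) (fun=> 1) s t `<=` A -> ae_le f c A -> unit_mass s t <= c * (t - s).
Proof.
move=> st sA /(ae_leS sA) h.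
have : ae_le f c (cyl (fun=> 0) (fun=> 1) s t).
  apply: ae_leS h => -[y u] [yab us]; split => // i.
  by have /andP[h0 h1] := yab i; rewrite h1 andbT (le_trans _ h0)// lerN10.
move=> /(cint_ae_le intf); rewrite st => /(_ _ isT) h'.
rewrite big1 ?mul1r in h'; last by move=> i _; rewrite subr0.
by apply: h' => i; exact: ler01.
Qed.

Lemma mass_step (M : nat) (r : R) : (0 < M)%N ->
  unit_mass r (r + len M%:R^-1) <=
  unit_mass (r + lag M%:R^-1) (r + lag M%:R^-1 + len M%:R^-1).
Proof.
move=> M0; set lg := lag _; set ln := len _.
have ln0 : 0 < ln by apply: len_gt0 => //; rewrite invr_gt0 ltr0n.
have := mass_ae_le _ (@subset_refl _ _) (@ae_le_box 1 M r isT M0).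
rewrite -/lg -/ln lerDl (ltW ln0) => /(_ isT).
by rewrite (_ : r + ln - r = ln); [rewrite divfK ?gt_eqF|ring].
Qed.

(** The outer induction shifts by one lag at a time; the inner one cuts the interval into [j] pieces
    of duration [len], to which [mass_step] applies. *)
Lemma mass_shift_scale (M j k : nat) (r : R) : (0 < M)%N ->
  unit_mass r (r + len M%:R^-1 * j%:R) <=
  unit_mass (r + lag M%:R^-1 * k%:R) (r + lag M%:R^-1 * k%:R + len M%:R^-1 * j%:R).
Proof.
move=> M0; set lg := lag _; set ln := len _.
have ln0 : 0 < ln by apply: len_gt0 => //; rewrite invr_gt0 ltr0n.
elim: k => [|k IH]; first by rewrite mulr0 addr0.
apply: (le_trans IH).
rewrite (_ : r + lg * k.+1%:R = r + lg * k%:R + lg); last by rewrite -(natr1 k); ring.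
elim: j {IH} => [|j IH]; first by rewrite mulr0 !addr0 /unit_mass !cintxx.
set q := r + lg * k%:R in IH *.
have lnj : 0 <= ln * j%:R by apply: mulr_ge0 => //; exact: ltW.
rewrite -(natr1 j) mulrDr mulr1.
rewrite (@mass_add q (q + ln * j%:R)); last by apply/andP; split; lra.
rewrite (@mass_add (q + lg) (q + lg + ln * j%:R)); last by apply/andP; split; lra.
apply: lerD => //.
have := @mass_step M (q + ln * j%:R) M0; rewrite -/lg -/ln.
by rewrite !addrA (addrAC q (ln * j%:R) lg).
Qed.

Lemma exists_mesh e : 0 < e -> exists2 M, (0 < M)%N &
  [/\ 0 < lag M%:R^-1, 0 < len M%:R^-1, len M%:R^-1 <= lag M%:R^-1 & lag M%:R^-1 <= e].
Proof.
move=> e0; have [M M0] := @exists_scale R p gamma p1 gamma0 1 e ltr01 e0.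
rewrite mul1r => h; exists M => //.
have L0 : 0 < M%:R^-1 :> R by rewrite invr_gt0 ltr0n.
have lg0 : 0 < lag M%:R^-1 by exact: lag_gt0.
split => //; [exact: len_gt0|exact: len_le_lag|].
by apply: le_trans h; rewrite ler_peMl ?ler1n// ltW.
Qed.

Lemma mass_small t0 e : 0 < e -> exists2 d : R, 0 < d &
  forall s t : R, t0 - d < s -> s <= t -> t < t0 + d -> `|unit_mass s t| <= e.
Proof. exact: cint_small. Qed.

Lemma truncn_div (b l : R) : 0 <= b -> 0 < l ->
  l * (Num.truncn (b / l))%:R <= b /\ b < l * (Num.truncn (b / l))%:R + l.
Proof.
move=> b0 l0; have /truncn_itv/andP[h1 h2] : 0 <= b / l by apply: divr_ge0 => //; exact: ltW.
split; first by rewrite mulrC -ler_pdivlMr.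
move: h2; rewrite ltr_pdivrMr// -natr1; lra.
Qed.

(** The durations [b] and [c] are approximated from below by multiples of [len] and [lag] on a fine
    mesh; absolute continuity absorbs the errors at the three displaced end points. *)
Lemma mass_shift (r b c : R) : 0 <= b -> 0 <= c ->
  unit_mass r (r + b) <= unit_mass (r + c) (r + c + b).
Proof.
move=> b0 c0; apply/ler_addgt0Pl => e3 e30; pose e := e3 / 3.
have e0 : 0 < e by rewrite divr_gt0.
have [d1 d10 h1] := mass_small (r + b) e0.
have [d2 d20 h2] := mass_small (r + c) e0.
have [d3 d30 h3] := mass_small (r + c + b) e0.
pose d := Num.min d1 (Num.min d2 d3).
have [dd1 dd2 dd3] : [/\ d <= d1, d <= d2 & d <= d3] by split; rewrite /d !ge_min lexx ?orbT.
have d0 : 0 < d by rewrite /d !lt_min d10 d20.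
(* The end point [r + c + b] collects the errors of both roundings, which stay below [2 d / 3]. *)
have [M M0] : exists2 M, (0 < M)%N & [/\ 0 < lag M%:R^-1, 0 < len M%:R^-1,
    len M%:R^-1 <= lag M%:R^-1 & lag M%:R^-1 <= d / 3] by apply: exists_mesh; rewrite divr_gt0.
set lg := lag _; set ln := len _ => -[lg0 ln0 lnlg lgd].
have [] := truncn_div b0 ln0; set j := Num.truncn _ => j1 j2.
have [] := truncn_div c0 lg0; set k := Num.truncn _ => k1 k2.
have lnj : 0 <= ln * j%:R by apply: mulr_ge0 => //; exact: ltW.
have := @mass_shift_scale M j k r M0; rewrite -/lg -/ln.
set s := r + lg * k%:R; set t := s + ln * j%:R => hs.
have sE : s = r + lg * k%:R by [].
have tE : t = s + ln * j%:R by [].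
clearbody t; clearbody s; clearbody j k lg ln d.
have A1 : unit_mass r (r + b) =
    unit_mass r (r + ln * j%:R) + unit_mass (r + ln * j%:R) (r + b).
  by apply: mass_add; rewrite lerDl lnj lerD2l.
have src : s <= r + c by rewrite sE lerD2l.
have tcb : t <= r + c + b by rewrite tE lerD.
have A2 : unit_mass s (r + c + b) = unit_mass s t + unit_mass t (r + c + b).
  by apply: mass_add; rewrite tcb andbT tE lerDl.
have A3 : unit_mass s (r + c + b) = unit_mass s (r + c) + unit_mass (r + c) (r + c + b).
  by apply: mass_add; rewrite src lerDl.
have g1 : r + b - d1 < r + ln * j%:R by clear -j2 lnlg lgd dd1 d0; lra.
have g2 : r + c - d2 < s by clear -sE k2 lgd dd2 d0; lra.
have g3 : r + c + b - d3 < t by clear -sE tE j2 k2 lnlg lgd dd3 d0; lra.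
have : `|unit_mass (r + ln * j%:R) (r + b)| <= e by apply: h1; rewrite ?lerD2l ?ltrDl.
have : `|unit_mass s (r + c)| <= e by apply: h2; rewrite ?ltrDl.
have : `|unit_mass t (r + c + b)| <= e by apply: h3; rewrite ?ltrDl.
move: hs A1 A2 A3; rewrite /e !ler_norml.
move: (unit_mass r (r + b)) (unit_mass r (r + ln * j%:R)) (unit_mass (r + ln * j%:R) (r + b))
  (unit_mass s t) (unit_mass s (r + c + b)) (unit_mass s (r + c))
  (unit_mass t (r + c + b)) (unit_mass (r + c) (r + c + b)).
clear; move=> x1 x2 x3 x4 x5 x6 x7 x8 h1 h2 h3 h4 /andP[? ?] /andP[? ?] /andP[? ?]; lra.
Qed.

End unit_cube.

(** * The temporal profile *)

Section profile.
Context (R : realType) (n : nat) (p gamma : R).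
Hypotheses (p1 : 1 < p) (gamma0 : 0 < gamma) (gamma1 : gamma < 1).
Variable f : spacetime R n -> R.
Hypotheses (intf : cyl_integrable f) (norm0 : BMOplus_norm p gamma f = 0%E).
Local Notation mu := (lebesgue_spacetime R n).
Local Notation len := (parabolic_len p gamma).
Local Notation lag := (parabolic_lag p gamma).
Local Notation mass := (unit_mass f).

Lemma mass_tile (q s l : R) (j : nat) : 0 <= l -> q <= s ->
  mass q (q + l) * j%:R <= mass s (s + l * j%:R).
Proof.
move=> l0 qs; elim: j => [|j IH]; first by rewrite !mulr0 addr0 /unit_mass cintxx.
have lj : 0 <= l * j%:R by apply: mulr_ge0.
rewrite (@mass_add _ _ _ intf s (s + l * j%:R)); last first.
  by rewrite lerDl lj lerD2l ler_wpM2l// ler_nat.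
rewrite -(natr1 j) mulrDr mulr1 lerD//.
have c0 : 0 <= s + l * j%:R - q by rewrite subr_ge0 (le_trans qs)// lerDl.
have := mass_shift p1 gamma0 gamma1 intf norm0 q l0 c0.
rewrite (_ : q + (s + l * j%:R - q) = s + l * j%:R); last by ring.
by rewrite mulrDr mulr1 addrA.
Qed.

(** Disjoint later copies of the short interval fill [[s, s + b[] except for a remainder shorter
    than one copy, and each has at least the mass of the original. Half of the error [e * b] pays
    for the mass of the remainder, half for its duration. *)
Lemma exists_slope_le (s b e : R) : 0 < b -> 0 < e -> exists2 M, (0 < M)%N &
  [/\ 0 < len M%:R^-1, lag M%:R^-1 <= e & forall q, q <= s ->
    mass q (q + len M%:R^-1) / len M%:R^-1 <= mass s (s + b) / b + e].
Proof.
move=> b0 e0; set m := mass s (s + b).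
pose eta := e * b / 2; have eta0 : 0 < eta by rewrite divr_gt0// mulr_gt0.
have [d d0 hd] := mass_small intf (s + b) eta0.
(* An upper bound for the slope over the short interval, valid once the copies fill at least half of
   [b]. *)
pose C := (`|m| + eta) / (b / 2).
have C0 : 0 <= C by apply: divr_ge0; [rewrite addr_ge0// ltW|rewrite ltW// divr_gt0].
pose g := Num.min e (Num.min (d / 2) (Num.min (b / 2) (eta / (C + 1)))).
have C10 : 0 < C + 1 by rewrite ltr_wpDl.
have g0 : 0 < g by rewrite !lt_min e0 (divr_gt0 d0)// (divr_gt0 b0)// (divr_gt0 eta0).
have [ge gd gb gC] : [/\ g <= e, g <= d / 2, g <= b / 2 & g <= eta / (C + 1)].
  by split; rewrite /g !ge_min lexx ?orbT.
have [M M0 []] := exists_mesh p1 gamma0 gamma1 g0.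
set lg := lag _; set ln := len _ => lg0 ln0 lnlg lgg.
exists M => //; split => //; first exact: le_trans ge.
move=> q qs; have [] := truncn_div (ltW b0) ln0; set j := Num.truncn _ => j1 j2.
have etaE : e * b = eta + eta by rewrite /eta; field.
rewrite -/ln; clearbody j ln lg g.
have lnj0 : 0 <= ln * j%:R by apply: mulr_ge0 => //; exact: ltW.
have lnj : b / 2 <= ln * j%:R by lra.
have bj : b - ln * j%:R <= ln by lra.
have bj0 : 0 <= b - ln * j%:R by lra.
have h1 : mass q (q + ln) * j%:R <= m + eta.
  apply: (le_trans (mass_tile j (ltW ln0) qs)).
  have -> : m = mass s (s + ln * j%:R) + mass (s + ln * j%:R) (s + b).
    by apply: mass_add; rewrite // lerDl lnj0 lerD2l.
  have : `|mass (s + ln * j%:R) (s + b)| <= eta.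
    apply: hd; rewrite ?lerD2l ?ltrDl//.
    by clear -j2 lnlg lgg gd d0; lra.
  by rewrite ler_norml => /andP[+ _]; rewrite -addrA lerDl -lerBlDr sub0r.
set c := mass q (q + ln) / ln.
have h2 : c * (ln * j%:R) <= m + eta by rewrite mulrA divfK// gt_eqF.
have h3 : ln * ( C + 1) <= eta.
  rewrite -ler_pdivlMr; last by rewrite ltr_wpDl.
  exact: le_trans (le_trans lnlg lgg) gC.
rewrite -(ler_pM2r b0) [X in _ <= X]mulrDl divfK ?gt_eqF//.
rewrite etaE.
move: h2; move: (ln * j%:R) lnj0 lnj bj bj0 => x x0 xb xb' xb0 h2.
clearbody c eta m.
(* A nonpositive slope only helps when the length is increased from [x] to [b]; a positive one is at
   most [C]. *)
have [c0|c0] := leP c 0.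
  have : c * (b - x) <= 0 by apply: mulr_le0_ge0.
  by rewrite mulrBr; lra.
have cC : c <= C.
  rewrite /C ler_pdivlMr ?divr_gt0//.
  apply: (@le_trans _ _ (c * x)); first by rewrite ler_pM2l.
  by apply: (le_trans h2); rewrite lerD2r ler_norm.
have : c * (b - x) <= C * ln.
  by apply: ler_pM => //; exact: ltW.
by clear h1 hd; clearbody C; lra.
Qed.

(** Countably many cylinders, in space and backwards in time, cover the half-space up to a small gap
    before [s]. On each of them [ae_le_box] and [exists_slope_le] give the bound up to a small
    error. *)
Lemma ae_le_slope (s b : R) : 0 < b ->
  ae_le f (mass s (s + b) / b) [set z | z.2 < s].
Proof.
move=> b0; set c := _ / _.
have key k : {ae mu, forall z, z.2 < s - k.+1%:R^-1 -> f z <= c + k.+1%:R^-1}.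
  have e0 : 0 < k.+1%:R^-1 :> R by rewrite invr_gt0.
  have [M M0 []] := exists_slope_le s b0 e0.
  set ln := len _; set lg := lag _ => ln0 lge hq.
  have hr (u x : R) : x <= s - lg - u -> s - lg - u < x + ln / 2 ->
      s - lg - (x + ln / 2) <= u < s - lg - (x + ln / 2) + ln.
    by move=> *; apply/andP; split; lra.
  (* Starting times advance by half the duration, so consecutive cylinders overlap and no time is
     lost at half-open ends. One lag after [r i] is still before [s], as [exists_slope_le]
     requires. *)
  pose r i := s - lg - ln / 2 * i.+1%:R.
  have hbox i K : {ae mu, forall z, cyl (fun=> - K.+1%:R) (fun=> K.+1%:R) (r i) (r i + ln) z ->
      f z <= c + k.+1%:R^-1}.
    have := ae_le_box p1 gamma0 gamma1 intf norm0 (r i) (ltn0Sn K) M0.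
    apply: ae_leW; apply: hq; rewrite /r -/lg -/ln.
    have : 0 <= ln / 2 * i.+1%:R by apply: mulr_ge0 => //; rewrite ltW// divr_gt0.
    by clear; set x := _ * _; lra.
  have : {ae mu, forall z (i K : nat),
      cyl (fun=> - K.+1%:R) (fun=> K.+1%:R) (r i) (r i + ln) z ->
      f z <= c + k.+1%:R^-1}.
    by apply: ae_foralln => i; apply: ae_foralln => K; exact: hbox.
  apply: filterS => -[y t] h /= ts.
  have y0 : 0 <= s - lg - t by rewrite subr_ge0 (le_trans (ltW ts))// lerD2l lerN2.
  have ln20 : 0 < ln / 2 by rewrite divr_gt0.
  have [i1 i2] := truncn_div y0 ln20.
  apply: (h (Num.truncn ((s - lg - t) / (ln / 2))) (Num.truncn (\sum_i `|y ord0 i|))).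
  split => [i /=|/=].
    have : `|y ord0 i| < (Num.truncn (\sum_i `|y ord0 i|)).+1%:R.
      apply: (@le_lt_trans _ _ (\sum_i `|y ord0 i|)); last exact: truncnS_gt.
      by rewrite (bigD1 i)//= lerDl sumr_ge0.
    by rewrite ltr_norml => /andP[/ltW -> ->].
  by rewrite in_itv/= /r -(natr1 (Num.truncn _)) mulrDr mulr1; exact: hr i1 i2.
have : {ae mu, forall z k, z.2 < s - k.+1%:R^-1 -> f z <= c + k.+1%:R^-1} by exact: ae_foralln.
rewrite /ae_le; apply: (@filterS _ (almost_everywhere mu)) => z h /= zs.
apply/ler_addgt0Pr => e e0.
pose k := Num.truncn (Num.max e^-1 (s - z.2)^-1).
have m0 : Num.max e^-1 (s - z.2)^-1 < k.+1%:R by exact: truncnS_gt.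
move: m0; rewrite gt_max => /andP[k1 k2].
apply: (le_trans (h k _)).
  by rewrite ltrBrDl -ltrBrDr invf_plt// posrE ?subr_gt0.
by rewrite lerD2l invf_ple// ?posrE// ltW.
Qed.

(** For a non-decreasing function of time, this is its right limit at [s]. Since [inf] takes a
    default value on sets not bounded below, [profile_has_inf] must supply a lower bound. *)
Definition profile (s : R) : R := inf [set mass s (s + b) / b | b in [set b | 0 < b]].

Lemma mass_le_slope (u v s b : R) : u <= v -> v <= s -> 0 < b ->
  mass u v <= mass s (s + b) / b * (v - u).
Proof.
move=> uv vs b0; apply: (mass_ae_le intf _ _ (ae_le_slope s b0)) => //.
by move=> [y t] [_]; rewrite /= in_itv/= => /andP[_ tv]; exact: lt_le_trans vs.
Qed.

Lemma profile_has_inf s : has_inf [set mass s (s + b) / b | b in [set b | 0 < b]].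
Proof.
split; first by exists (mass s (s + 1) / 1); exists 1 => //=.
exists (mass (s - 1) s) => _ [b /= b0 <-].
have := @mass_le_slope (s - 1) s s b _ (lexx _) b0.
rewrite (_ : s - (s - 1) = 1); last by ring.
by rewrite mulr1; apply; rewrite gerBl.
Qed.

Lemma profile_le s b : 0 < b -> profile s <= mass s (s + b) / b.
Proof. by move=> b0; apply: ge_inf; [exact: (profile_has_inf s).2|exists b]. Qed.

Lemma le_profile s c : (forall b, 0 < b -> c <= mass s (s + b) / b) -> c <= profile s.
Proof.
move=> h; apply: lb_le_inf; first exact: (profile_has_inf s).1.
by move=> _ [b /= b0 <-]; exact: h.
Qed.

(** The mean over [[s, t[] is one of the competitors at [s], and by [mass_le_slope] it is below
    every competitor at [t]. *)
Lemma profile_homo : {homo profile : s t / s <= t}.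
Proof.
move=> s t; rewrite le_eqVlt => /predU1P[->//|st].
apply: le_profile => b b0; have ts0 : 0 < t - s by rewrite subr_gt0.
apply: (le_trans (profile_le s ts0)).
by rewrite ler_pdivrMr// (addrC s) subrK; exact: mass_le_slope (ltW st) _ _.
Qed.

Lemma ae_le_profile s : ae_le f (profile s) [set z | z.2 < s].
Proof.
have h k : {ae mu, forall z, z.2 < s -> f z <= profile s + k.+1%:R^-1}.
  have e0 : 0 < k.+1%:R^-1 :> R by rewrite invr_gt0.
  have [_ [b /= b0 <-] /ltW hb] := inf_adherent e0 (profile_has_inf s).
  by have := ae_leW hb (ae_le_slope s b0).
have : {ae mu, forall z k, z.2 < s -> f z <= profile s + k.+1%:R^-1} by exact: ae_foralln.
rewrite /ae_le; apply: (@filterS _ (almost_everywhere mu)) => z hz zs.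
apply/ler_addgt0Pr => e e0.
apply: (le_trans (hz (Num.truncn e^-1) zs)).
by rewrite lerD2l invf_ple// ?posrE// ltW// truncnS_gt.
Qed.

End profile.

(** * Identification with the profile *)

Section time_functions.
Context (R : realType) (n : nat).
Local Notation mu := (lebesgue_spacetime R n).
Variable a : R -> R.
Hypothesis a_homo : {homo a : s t / s <= t}.

Lemma measurable_time_fun :
  measurable_fun setT ((fun z => a z.2) : spacetime R n -> measurableTypeR R).
Proof.
have m2 : measurable_fun setT (snd : spacetime R n -> measurableTypeR R).
  move=> _ Y mY; rewrite setTI.
  rewrite (_ : _ @^-1` _ = setT `*` Y); last by apply/seteqP; split => -[y t] //= [].
  by apply: measurable_spacetime; exact: measurableX.
by apply: (measurableT_comp _ m2); apply: nondecreasing_measurable.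
Qed.

Lemma time_fun_integrable : cyl_integrable (fun z : spacetime R n => a z.2).
Proof.
move=> l u s t; apply: measurable_bounded_integrable; first exact: measurable_cyl.
- have [/andP[h st]|] := boolP ([forall i, l i <= u i] && (s <= t)).
    by rewrite [X in (X < _)%E]lebesgue_cyl ?ltry// => i; exact: (forallP h).
  move=> h; rewrite (_ : cyl l u s t = set0) ?measure0 ?ltry//.
  rewrite -subset0 => -[y r] [yl]; rewrite /= in_itv/= => /andP[sr rt].
  move/negP: h; apply; apply/andP; split; last exact: le_trans (ltW rt).
  by apply/forallP => i; have /andP[h1 /ltW] := yl i; exact: le_trans.
- exact: measurable_funTS measurable_time_fun.
- exists (Num.max `|a s| `|a t|); split; first exact: num_real.
  move=> x mx [y r] [_] /=; rewrite in_itv/= => /andP[sr rt].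
  have h1 := a_homo sr; have h2 := a_homo (ltW rt).
  move: mx; rewrite gt_max => /andP[m1 m2].
  rewrite ler_norml; apply/andP; split.
    apply: le_trans h1; rewrite lerNl (le_trans _ (ltW m1))//.
    by rewrite -normrN ler_norm.
  by rewrite (le_trans h2)// (le_trans (ler_norm _))// ltW.
Qed.

End time_functions.

(** * Vanishing distance between [f] and its profile *)

Section squeeze.
Context (R : realType) (n : nat) (p gamma : R).
Hypotheses (p1 : 1 < p) (gamma0 : 0 < gamma) (gamma1 : gamma < 1).
Variable f : spacetime R n -> R.
Hypotheses (intf : cyl_integrable f) (norm0 : BMOplus_norm p gamma f = 0%E).
Local Notation mu := (lebesgue_spacetime R n).
Local Notation a := (profile f).

Let a_homo : {homo a : s t / s <= t} := profile_homo p1 gamma0 gamma1 intf norm0.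

Let g (z : spacetime R n) : R := f z - a z.2.

Let intg : cyl_integrable g.
Proof.
move=> l u s t; have := integrableB (measurable_cyl l u s t) (intf l u s t)
  (time_fun_integrable a_homo l u s t).
exact.
Qed.

Let intng : cyl_integrable (fun z => `|g z|) := cyl_integrable_norm intg.

(** Almost everywhere on the slice [f] is at most [a t], while its mean there is at least [a s].
    Adding [f] to [|g|] turns the absolute deviation into a quantity with a pointwise upper
    bound. *)
Lemma slice_dist_le (K : nat) (s t : R) : (0 < K)%N -> s < t ->
  cint (fun z => `|g z|) (fun=> - K%:R) (fun=> K%:R) s t <=
  2 * (\prod_(i < n) (K%:R + K%:R)) * ((a t - a s) * (t - s)).
Proof.
move=> K0 st; set V := \prod_(i < n) _.
have ts0 : 0 < t - s by rewrite subr_gt0.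
have V0 : 0 <= V by apply: prodr_ge0 => i _; exact: addr_ge0.
have inth : cyl_integrable (fun z => `|g z| + f z).
  move=> l u s' t';
  exact: (integrableD (measurable_cyl l u s' t') (intng l u s' t') (intf l u s' t')).
(* The sum is [2 f - a r] where [f] exceeds [a r], and [a r] elsewhere; [f <= a t] and
   [a s <= a r <= a t] bound both. *)
have : ae_le (fun z => `|g z| + f z) (2 * a t - a s) (cyl (fun=> - K%:R) (fun=> K%:R) s t).
  have := ae_le_profile p1 gamma0 gamma1 intf norm0 t.
  rewrite /ae_le; apply: (@filterS _ (almost_everywhere mu)) => -[y r] h [_].
  rewrite /= in_itv/= => /andP[sr rt].
  have {}h := h rt; have h1 := a_homo sr; have h2 := a_homo (ltW rt).
  rewrite /g /=; move: h h1 h2; move: (f _) (a t) (a s) (a r) => x x1 x2 x3 /=.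
  move=> *; have [h|h] := lerP 0 (x - x3).
    by rewrite ger0_norm//; lra.
  by rewrite ltr0_norm//; lra.
move=> /(cint_ae_le inth); rewrite (ltW st) => /(_ _ isT) h.
have {}h : cint (fun z => `|g z| + f z) (fun=> - K%:R) (fun=> K%:R) s t <=
    (2 * a t - a s) * (V * (t - s)).
  apply: (le_trans (h _)).
    by move=> i; rewrite (@le_trans _ _ 0)// oppr_le0.
  by rewrite /V; under eq_bigr do rewrite opprK.
have hD : cint (fun z => `|g z| + f z) (fun=> - K%:R) (fun=> K%:R) s t =
    cint (fun z => `|g z|) (fun=> - K%:R) (fun=> K%:R) s t +
    cint f (fun=> - K%:R) (fun=> K%:R) s t.
  by apply: RintegralD; [exact: measurable_cyl|exact: intng|exact: intf].
have fE : cint f (fun=> - K%:R) (fun=> K%:R) s t = V * unit_mass f s t.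
  have KK : forall i : 'I_n, (0 < K + K)%N by move=> i; rewrite addn_gt0 K0.
  have := @lattice_mass R n p gamma p1 gamma0 gamma1 f intf norm0 K 1 s (t - s) _ _
    isT (ltW ts0) KK.
  rewrite (addrC s) subrK.
  rewrite (_ : lattice _ _ (fun=> 0%N) = fun=> - K%:R); last first.
    by apply/funext => i; rewrite /lattice mulr0 addr0.
  rewrite (_ : lattice _ _ (fun=> (K + K)%N) = fun=> K%:R); last first.
    by apply/funext => i; rewrite /lattice natrD invr1; ring.
  move=> ->; congr (_ * _); apply: eq_bigr => i _.
  by rewrite natrD subr0 divr1.
have am : a s * (t - s) <= unit_mass f s t.
  have := profile_le p1 gamma0 gamma1 intf norm0 s ts0.
  by rewrite (addrC s) subrK ler_pdivlMr.
have : V * (a s * (t - s)) <= V * unit_mass f s t by apply: ler_wpM2l.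
rewrite -fE => {am}; rewrite hD in h.
move: h; move: (cint _ _ _ _ _) (cint f _ _ _ _) (a s) (a t) => x1 x2 x3 x4; lra.
Qed.

(** Over [N] slices of equal height the increments of the profile telescope, so the total error is
    [W / N] for a constant [W]. *)
Lemma dist_eq0 (K : nat) : (0 < K)%N ->
  cint (fun z => `|g z|) (fun=> - K%:R) (fun=> K%:R) (- K%:R) K%:R = 0.
Proof.
move=> K0; set V := \prod_(i < n) (K%:R + K%:R : R).
have KR0 : 0 < K%:R :> R by rewrite ltr0n.
have V0 : 0 <= V by apply: prodr_ge0 => i _; exact: addr_ge0.
apply/eqP; rewrite eq_le; apply/andP; split; last exact: cint_ge0.
have step (N m : nat) : (0 < N)%N -> let h := (K%:R + K%:R) / N%:R in
    (cint (fun z => `|g z|) (fun=> - K%:R) (fun=> K%:R) (- K%:R) (- K%:R + h * m%:R) <=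
    2 * V * h * (a (- K%:R + h * m%:R) - a (- K%:R)) : Prop).
  move=> N0 h; have h0 : 0 < h by rewrite divr_gt0 ?addr_gt0// ltr0n.
  elim: m => [|m IH]; first by rewrite mulr0 addr0 cintxx subrr mulr0.
  have hm : 0 <= h * m%:R by apply: mulr_ge0 => //; exact: ltW.
  rewrite (_ : - K%:R + h * m.+1%:R = - K%:R + h * m%:R + h); last by rewrite -(natr1 m); ring.
  set q := - K%:R + h * m%:R in IH *.
  have qh : - K%:R <= q <= q + h by rewrite /q lerDl hm lerDl ltW.
  rewrite (cint_time _ _ intng qh).
  have := @slice_dist_le K q (q + h) K0; rewrite ltrDl => /(_ h0).
  rewrite (addrC q) addrK -/V.
  move: IH; move: (cint _ _ _ _ q) (cint _ _ _ q _) (a _) (a _) (a _) => x1 x2 x3 x4 x5.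
  lra.
apply/ler_addgt0Pr => e e0; rewrite add0r.
pose W := 2 * V * (K%:R + K%:R) * (a K%:R - a (- K%:R)).
have W0 : 0 <= W.
  apply: mulr_ge0; first by apply: mulr_ge0; [exact: mulr_ge0|exact: addr_ge0].
  rewrite subr_ge0; apply: a_homo.
  by rewrite (@le_trans _ _ 0)// oppr_le0.
pose N := (Num.truncn (W / e)).+1.
have N0 : (0 < N)%N by [].
have NR0 : 0 < N%:R :> R by rewrite ltr0n.
have := step N N N0; rewrite /= divfK ?gt_eqF// addKr => h.
apply: (le_trans h).
rewrite [leLHS](_ : _ = W / N%:R); last by rewrite /W [RHS]mulrAC !mulrA.
rewrite ler_pdivrMr// mulrC -ler_pdivrMr//.
exact/ltW/truncnS_gt.
Qed.

Lemma ae_eq_profile : {ae mu, forall z, f z = a z.2}.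
Proof.
have h (K : nat) : {ae mu, forall z,
    cyl (fun=> - K.+1%:R) (fun=> K.+1%:R) (- K.+1%:R) K.+1%:R z -> f z = a z.2}.
  set A := cyl _ _ _ _; have mA : measurable A by exact: measurable_cyl.
  have : (\int[mu]_(z in A) `|(g z)%:E| = 0)%E.
    have := @dist_eq0 K.+1 isT; rewrite /cint /Rintegral => h0.
    rewrite -[LHS]fineK; first exact: (congr1 EFin h0).
    exact: integrable_fin_num (intng _ _ _ _).
  move/(ae_eq_integral_abs mu mA) => [].
    by have := intg (fun=> - K.+1%:R) (fun=> K.+1%:R) (- K.+1%:R) K.+1%:R; exact: measurable_int.
  move=> N [mN N0 sub]; exists N; split => //.
  apply: subset_trans sub => z /=; apply: contra_not => hz zA.
  by have := hz zA => -[] /eqP; rewrite subr_eq0 => /eqP.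
have : {ae mu, forall z K,
    cyl (fun=> - K.+1%:R) (fun=> K.+1%:R) (- K.+1%:R) K.+1%:R z -> f z = a z.2}.
  exact: ae_foralln.
apply: (@filterS _ (almost_everywhere mu)) => -[y t] hz.
pose S := \sum_i `|y ord0 i| + `|t : R|.
have S1 : S < (Num.truncn S).+1%:R by exact: truncnS_gt.
have SB (x : R) : `|x| <= S -> - (Num.truncn S).+1%:R <= x < (Num.truncn S).+1%:R.
  by move=> /le_lt_trans /(_ S1); rewrite ltr_norml => /andP[/ltW -> ->].
apply: (hz (Num.truncn S)); split => [i|].
  apply: SB; rewrite /S (bigD1 i)//= -addrA lerDl addr_ge0//.
  by rewrite sumr_ge0.
by rewrite /= in_itv/=; apply: SB; rewrite lerDr sumr_ge0.
Qed.

End squeeze.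

(** * Functions of time *)

Section time_functions_BMO.
Context (R : realType) (n : nat).
Local Notation mu := (lebesgue_spacetime R n).
Variables (f : spacetime R n -> R) (a : R -> R).
Hypothesis mf : measurable_fun setT (f : spacetime R n -> measurableTypeR R).
Hypothesis a_homo : {homo a : s t / s <= t}.
Hypothesis fa : {ae mu, forall z, f z = a z.2}.

Let mEf A : measurable_fun A (EFin \o f).
Proof. by apply/measurable_EFinP; exact: measurable_funTS mf. Qed.

Let mEa A : measurable_fun A (EFin \o (fun z : spacetime R n => a z.2)).
Proof. by apply/measurable_EFinP; apply: measurable_funTS; exact: measurable_time_fun. Qed.

Lemma ae_time_fun_integrable : cyl_integrable f.
Proof.
move=> l u s t; have mc := measurable_cyl l u s t.
apply/integrableP; split; first exact: mEf.
have /integrableP[_ ia] := time_fun_integrable a_homo l u s t.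
have faE : (\int[mu]_(z in cyl l u s t) `|(f z)%:E| =
    \int[mu]_(z in cyl l u s t) `|(a z.2)%:E|)%E.
  apply: (@ge0_ae_eq_integral _ _ _ mu).
  - exact: mc.
  - by apply: (@measurableT_comp _ _ _ _ _ _ abse); [|exact: mEf].
  - by apply: (@measurableT_comp _ _ _ _ _ _ abse); [|exact: mEa].
  - by move=> z _; exact: abse_ge0.
  - by move=> z _; exact: abse_ge0.
  - by move: fa; apply: (@filterS _ (almost_everywhere mu)) => z /= ->.
by rewrite [X in (X < _)%E]faE.
Qed.

Lemma compact_sub_cyl (K : set ('rV[R]_n * R)) : compact K ->
  exists c : R, K `<=` (cyl (fun=> - c) (fun=> c) (- c) c : set (spacetime R n)).
Proof.
move=> cK.
have bnd (h : 'rV[R]_n * R -> R) : continuous h ->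
    exists M : R, forall z, K z -> `|h z| <= M.
  move=> ch; have : compact (h @` K).
    by apply: continuous_compact => //; exact: continuous_subspaceT.
  move=> /compact_bounded[M [_ hM]]; exists (M + 1) => z Kz.
  by apply: (hM (M + 1)); [rewrite ltrDl|exists z].
have [T hT] := bnd snd (fun z => cvg_snd).
have coord i : exists M : R, forall z, K z -> `|z.1 ord0 i| <= M.
  apply: (bnd (fun z => z.1 ord0 i)) => z.
  apply: (@continuous_comp _ _ _ fst (fun y : 'rV[R]_n => y ord0 i)); first exact: cvg_fst.
  exact: coord_continuous.
have [B hB] := choice coord.
pose c := `|T| + \sum_i `|B i| + 1; exists c => -[y t] Kz.
have inc (x M : R) : `|x| <= M -> `|M| < c -> - c <= x < c.
  move=> xM Mc; have : `|x| < c by rewrite (le_lt_trans xM)// (le_lt_trans (ler_norm _)).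
  by rewrite ltr_norml => /andP[/ltW -> ->].
split => [i|].
  apply: inc; first exact: (hB i _ Kz).
  have Bi : `|B i| <= \sum_i `|B i| by rewrite (bigD1 i)//= lerDl sumr_ge0.
  by rewrite /c (le_lt_trans Bi)// ltr_pwDr// lerDr.
rewrite /= in_itv/=; apply: inc; first exact: (hT _ Kz).
by rewrite /c -addrA ltrDl ltr_wpDl// sumr_ge0.
Qed.

Lemma ae_time_fun_locally_integrable : locally_integrable_spacetime f.
Proof.
split => // K /compact_sub_cyl[c Kc].
have /integrableP[_ i1] := ae_time_fun_integrable (fun=> - c) (fun=> c) (- c) c.
apply/integrableP; split; first exact: mEf.
apply: le_lt_trans i1.
(* [K] has not been shown to be measurable, so the integrals are compared through
   their definition as suprema over simple functions. *)
rewrite !ge0_integralE//; apply: ge_ereal_sup => _ [h /= hK <-].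
apply: ereal_sup_ubound; exists h => //= z; apply: (le_trans (hK z)).
rewrite !patchE; have [/set_mem Kz|_] := boolP (z \in K); first by rewrite mem_set//; exact: Kc.
case: ifP => _; last exact: lexx.
by change (0%:E <= `|f z|%:E)%E; rewrite lee_fin.
Qed.

Variables p gamma : R.
Hypotheses (gamma0 : 0 < gamma) (gamma1 : gamma < 1).

(** The value of [a] at the central time of a rectangle separates the two parts: [f] is almost
    everywhere at most this value on R^-, and its mean over R^+ is at least this value. *)
Lemma ae_time_fun_BMOplus_norm : BMOplus_norm p gamma f = 0%E.
Proof.
rewrite /BMOplus_norm.
suff h (Q : parabolic_rectangle R n) : mean (lower_part p gamma Q)
      (fun z => Num.max (f z - fine (mean (upper_part p gamma Q) f)) 0)%R = 0%E.
  (* A rectangle has to be exhibited, since the supremum of the empty set would be [-oo]. *)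
  rewrite [X in ereal_sup X](_ : _ = [set 0%E]) ?ereal_sup1//.
  apply/seteqP; split => [_ [Q _ <-]|_ ->] /=; first exact: h.
  by exists (ParabolicRectangle 0 0 ltr01); last exact: h.
case: Q => x t L L0.
pose l i := x ord0 i - L / 2; pose u i := x ord0 i + L / 2.
have lowE : lower_part p gamma (ParabolicRectangle x t L0) =
  cyl l u (t - L `^ p) (t - gamma * L `^ p) by [].
have upE : upper_part p gamma (ParabolicRectangle x t L0) =
  cyl l u (t + gamma * L `^ p) (t + L `^ p) by [].
rewrite lowE upE mean_cyl; last exact: ae_time_fun_integrable.
have Lp0 : 0 < L `^ p by exact: powR_gt0.
have glp : 0 <= gamma * L `^ p by apply: mulr_ge0; exact: ltW.
have g1lp : gamma * L `^ p < L `^ p by rewrite gtr_pMl.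
set U := cyl l u (t + gamma * L `^ p) (t + L `^ p).
set D := cyl l u (t - L `^ p) (t - gamma * L `^ p).
have mU : measurable U by exact: measurable_cyl.
have mD : measurable D by exact: measurable_cyl.
have muU : mu U = ((\prod_i (u i - l i)) * (t + L `^ p - (t + gamma * L `^ p)))%:E.
  rewrite /U lebesgue_cyl//; last by rewrite lerD2l ltW.
  by move=> i; rewrite /u /l lerD2l; lra.
have U0 : 0 < fine (mu U).
  rewrite muU/= mulr_gt0 ?subr_gt0 ?ltrD2l// prodr_gt0// => i _.
  by rewrite /u /l; lra.
have am : a t <= (fine (mu U))^-1 * cint f l u (t + gamma * L `^ p) (t + L `^ p).
  rewrite mulrC ler_pdivlMr// -Rintegral_cst// /cint -/U.
  have -> : \int[mu]_(z in U) f z = \int[mu]_(z in U) a z.2.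
    congr fine; apply: (@ae_eq_integral _ _ _ mu).
    - exact: mU.
    - exact: mEf.
    - exact: mEa.
    by move: fa; apply: (@filterS _ (almost_everywhere mu)) => z /= ->.
  apply: le_Rintegral => //.
  - apply: measurable_bounded_integrable => //; first by rewrite [X in (X < _)%E]muU ltry.
    by exists `|a t|; split => [|y cy z _ /=]; [exact: num_real|exact: ltW].
  - exact: time_fun_integrable.
  - move=> [y r] [_]; rewrite /= in_itv/= => /andP[tr _]; apply: a_homo.
    by apply: le_trans tr; rewrite lerDl.
move: am; set m := _ * cint _ _ _ _ _ => am.
rewrite /mean (_ : (\int[mu]_(z in D) _)%E = 0%E) ?mule0//.
rewrite -(integral0 mu D); apply: (@ge0_ae_eq_integral _ _ _ mu).
- exact: mD.
- apply/measurable_EFinP; apply: measurable_maxr; last exact: measurable_cst.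
  by apply: measurable_funB; [exact: measurable_funTS mf|exact: measurable_cst].
- exact: measurable_cst.
- by move=> z _; rewrite lee_fin le_max lexx orbT.
- by [].
move: fa; apply: (@filterS _ (almost_everywhere mu)) => -[y r] /= -> [_].
rewrite /= in_itv/= => /andP[_ rt]; congr EFin; apply/max_idPr; rewrite subr_le0.
apply: le_trans am; apply: a_homo; apply: (le_trans (ltW rt)).
by rewrite gerBl.
Qed.

End time_functions_BMO.

Theorem corollary3p7 (R : realType) (n : nat) (p gamma : R)
    (hp : 1 < p) (hgamma : 0 < gamma < 1)
    (f : spacetime R n -> R)
    (mf : measurable_fun setT (f : spacetime R n -> measurableTypeR R)) :
  [set g | BMOplus p gamma g /\ BMOplus_norm p gamma g = 0%E] f <->
  exists ftilde : R -> R, {homo ftilde : s t / s <= t} /\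
    {ae lebesgue_spacetime R n, forall z, f z = ftilde z.2}.
Proof.
have /andP[gamma0 gamma1] := hgamma; split => [[[lf _] norm0]|[a [a_homo fa]]].
  have intf := locally_integrable_cyl lf.
  exists (profile f); split; first exact: (profile_homo hp gamma0 gamma1 intf norm0).
  exact: (ae_eq_profile hp gamma0 gamma1 intf norm0).
have norm0 := ae_time_fun_BMOplus_norm mf a_homo fa p gamma0 gamma1.
split => //; split; last by rewrite norm0 ltry.
exact: ae_time_fun_locally_integrable mf a_homo fa.
Qed.
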